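(* Let $M$ be an orientable manifold and let $\mathcal{N}:TM\to TM$ be a Nijenhuis tensor, i.e. a $(1,1)$-tensor with $$\mathcal{N}[\mathcal{N}X,Y]+\mathcal{N}[X,\mathcal{N}Y]-\mathcal{N}^2[X,Y]-[\mathcal{N}X,\mathcal{N}Y]=0$$ for all vector fields $X,Y$. Consider the Lie algebroid $(TM,[\cdot,\cdot]_{\mathcal{N}},\rho_{\mathcal{N}})$ with bracket $[X,Y]_{\mathcal{N}}=[\mathcal{N}X,Y]+[X,\mathcal{N}Y]-\mathcal{N}[X,Y]$ and anchor $\rho_{\mathcal{N}}(X)=\mathcal{N}X$. Then the modular class of this Lie algebroid is the class, in its first Lie algebroid cohomology group, represented by the 1-form $\mathrm{d}(\operatorname{tr}\mathcal{N})$.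
   Context: For a Lie algebroid $A\to M$ with anchor $\rho$, let $\Omega^k(A)=\Gamma(\wedge^kA^* )$ and let $\mathrm{d}_A:\Omega^k(A)\to\Omega^{k+1}(A)$ be the de Rham type differential $$\mathrm{d}_A\omega(\alpha_0,\dots,\alpha_k)=\sum_{i}(-1)^i\rho(\alpha_i)\,\omega(\dots,\check\alpha_i,\dots)+\sum_{i<j}(-1)^{i+j}\omega([\alpha_i,\alpha_j],\dots,\check\alpha_i,\dots,\check\alpha_j,\dots).$$ Its cohomology $H^\bullet(A)$ is the Lie algebroid cohomology. For $\alpha\in\Gamma(A)$, $\mathcal{L}_\alpha$ on sections of $\wedge^\bullet A$ is the derivation extending $\beta\mapsto[\alpha,\beta]$ and $f\mapsto\rho(\alpha)f$. Modular class of $A$: assuming $\wedge^{\mathrm{top}}A$ and $\wedge^{\mathrm{top}}T^*M$ are trivial, choose nowhere vanishing sections $\eta$ and $\mu$ of them; $\xi_A\in\Omega^1(A)$ is the unique element such that $$(\mathcal{L}_\alpha\eta)\otimes\mu+\eta\otimes(\mathcal{L}_{\rho(\alpha)}\mu)=\xi_A(\alpha)\,\eta\otimes\mu\qquad\text{for all }\alpha\in\Gamma(A).$$ It is a $\mathrm{d}_A$-cocycle whose class $\operatorname{mod}(A)=[\xi_A]\in H^1(A)$ does not depend on $\eta,\mu$. For $A=(TM,[\cdot,\cdot]_{\mathcal{N}},\rho_{\mathcal{N}})$, elements of $\Omega^1(A)$ are ordinary 1-forms on $M$. *)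

(* Defs.v *)
From HB Require Import structures.
From mathcomp Require Import all_boot all_order all_algebra.
From mathcomp Require Import all_classical all_reals all_analysis.
From mathcomp Require Import ring lra.
Set Implicit Arguments.
Unset Strict Implicit.
Unset Printing Implicit Defensive.
Import Order.TTheory GRing.Theory Num.Theory.
Import numFieldNormedType.Exports.
Local Open Scope classical_set_scope.
Local Open Scope ring_scope.

Section SmoothEuclidean.
Variables (R : realType) (n : nat).
Implicit Types (U : set 'rV[R]_n) (f g : 'rV[R]_n -> R).

(* [f] is of class C^k on the open set [U]; its values outside [U] are
   irrelevant. *)
Fixpoint Ck (k : nat) U f : Prop :=
  (forall x, U x -> {for x, continuous f}) /\
  match k with
  | 0 => True
  | k'.+1 => forall i : 'I_n,
      (forall x, U x -> derivable f x (delta_mx 0 i)) /\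
      Ck k' U ('D_(delta_mx 0 i) f)
  end.

Definition smooth_on U f : Prop := forall k, Ck k U f.

Lemma CkW k U f : Ck k.+1 U f -> Ck k U f.
Proof.
elim: k f => [|k IH] f [cf df]; first by split.
by split=> // i; have [? /IH ?] := df i.
Qed.

Lemma Ck_cst k U (c : R) : Ck k U (cst c).
Proof.
have cc : forall x, U x -> {for x, continuous (cst c : 'rV[R]_n -> R)}.
  by move=> x _; exact: cst_continuous.
elim: k c cc => [|k IH] c cc; split=> // i; split; first by move=> x _; exact: derivable_cst.
suff -> : 'D_(delta_mx 0 i) (cst c : 'rV[R]_n -> R) = cst 0.
  by apply: IH => x _; exact: cst_continuous.
by apply/funext => x; rewrite derive_cst.
Qed.

Lemma Ck_ext k U f g : open U -> {in U, f =1 g} -> Ck k U f -> Ck k U g.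
Proof.
move=> oU.
have nfg (h h' : 'rV[R]_n -> R) : {in U, h =1 h'} ->
    forall x, U x -> \forall y \near x, h y = h' y.
  move=> hh' x Ux; apply: filterS (open_nbhs_nbhs (conj oU Ux)) => y Uy.
  exact/hh'/mem_set.
have cfg (h h' : 'rV[R]_n -> R) : {in U, h =1 h'} ->
    (forall x, U x -> {for x, continuous h}) ->
    forall x, U x -> {for x, continuous h'}.
  move=> hh' ch x Ux; have := ch x Ux.
  rewrite /prop_for /continuous_at -(hh' x (mem_set Ux)); apply: cvg_trans.
  exact: (near_eq_cvg (nfg _ _ hh' _ Ux)).
elim: k f g => [|k IH] f g fg [cf df]; split=> //; try exact: cfg cf.
move=> i; have [di ci] := df i; split.
  by move=> x Ux; apply: near_eq_derivable (di _ Ux); exact: nfg.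
by apply: IH ci => x /set_mem Ux; apply: near_eq_derive; exact: nfg.
Qed.

Lemma CkB k U f g : open U -> Ck k U f -> Ck k U g -> Ck k U (f - g).
Proof.
move=> oU; elim: k f g => [|k IH] f g [cf df] [cg dg].
  by split=> // x Ux; exact: (cvgB (cf x Ux) (cg x Ux)).
split=> [x Ux|i]; first by exact: (cvgB (cf x Ux) (cg x Ux)).
have [dfi cfi] := df i; have [dgi cgi] := dg i; split.
  by move=> x Ux; apply: derivableB; [exact: dfi|exact: dgi].
apply: (Ck_ext oU _ (IH _ _ cfi cgi)) => x /set_mem Ux.
by rewrite /= deriveB; [|exact: dfi|exact: dgi].
Qed.

Lemma CkD k U f g : open U -> Ck k U f -> Ck k U g -> Ck k U (f + g).
Proof.
move=> oU cf cg; rewrite -[g]opprK -[- g]add0r.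
by apply: CkB => //; apply: CkB => //; exact: Ck_cst.
Qed.

Lemma CkM k U f g : open U -> Ck k U f -> Ck k U g -> Ck k U (f * g).
Proof.
move=> oU; elim: k f g => [|k IH] f g Cf Cg; have [cf df] := Cf;
  have [cg dg] := Cg.
  by split=> // x Ux; exact: (cvgM (cf x Ux) (cg x Ux)).
split=> [x Ux|i]; first by exact: (cvgM (cf x Ux) (cg x Ux)).
have [dfi cfi] := df i; have [dgi cgi] := dg i; split.
  by move=> x Ux; apply: derivableM; [exact: dfi|exact: dgi].
apply: (Ck_ext oU _ (CkD oU (IH _ _ (CkW Cf) cgi) (IH _ _ (CkW Cg) cfi))).
by move=> x /set_mem Ux; rewrite /= deriveM; [|exact: dfi|exact: dgi].
Qed.

End SmoothEuclidean.

Section Manifold.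
Variables (R : realType) (n : nat).

(* [chart_inv] is only meaningful on the image of [chart_dom]. *)
Record chart (T : topologicalType) := Chart {
  chart_dom : set T;
  chart_map : T -> 'rV[R]_n;
  chart_inv : 'rV[R]_n -> T;
  chart_open : open chart_dom;
  chart_img_open : open (chart_map @` chart_dom);
  chart_mapK : {in chart_dom, cancel chart_map chart_inv};
  chart_map_continuous : {within chart_dom, continuous chart_map};
  chart_inv_continuous :
    {within chart_map @` chart_dom, continuous chart_inv} }.

Record manifold := Manifold {
  manifold_top :> topologicalType;
  atlas : set (chart manifold_top);
  manifold_hausdorff : hausdorff_space manifold_top;
  manifold_second_countable : @second_countable manifold_top;
  atlas_cover : forall p : manifold_top, exists2 c, atlas c & chart_dom c p;
  atlas_smooth : forall c c', atlas c -> atlas c' -> forall i : 'I_n,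
    smooth_on (chart_map c @` (chart_dom c `&` chart_dom c'))
              (fun x => chart_map c' (chart_inv c x) 0 i) }.

Definition smooth_fun (M : manifold) (f : M -> R) : Prop :=
  forall c, atlas c -> smooth_on (chart_map c @` chart_dom c) (f \o chart_inv c).

End Manifold.

Section SmoothFunctions.
Variables (R : realType) (n : nat) (M : manifold R n).

Definition smooth_pred : {pred M -> R} := fun f => `[< smooth_fun f >].

Lemma smooth_fun_subring : subring_closed smooth_pred.
Proof.
split; first by apply/asboolP => c _ k; exact: Ck_cst.
- move=> f g /asboolP sf /asboolP sg; apply/asboolP => c ac k.
  by apply: (@CkB _ _ _ _ (f \o chart_inv c) (g \o chart_inv c));
     [exact: chart_img_open|exact: sf|exact: sg].
- move=> f g /asboolP sf /asboolP sg; apply/asboolP => c ac k.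
  by apply: (@CkM _ _ _ _ (f \o chart_inv c) (g \o chart_inv c));
     [exact: chart_img_open|exact: sf|exact: sg].
Qed.

Record cinf := Cinf { cinf_fun :> M -> R; _ : cinf_fun \in smooth_pred }.

HB.instance Definition _ := [isSub for cinf_fun].
HB.instance Definition _ := [Choice of cinf by <:].
HB.instance Definition _ :=
  GRing.SubChoice_isSubComPzRing.Build (M -> R) smooth_pred cinf
    smooth_fun_subring.

End SmoothFunctions.

Section CinfTheory.
Variables (R : realType) (n : nat) (M : manifold R n).

Lemma cinfP (f g : cinf M) : (forall p, f p = g p) -> f = g.
Proof. by move=> fg; apply/val_inj/funext. Qed.

Lemma cinfD (f g : cinf M) p : (f + g) p = f p + g p. Proof. by []. Qed.
Lemma cinfN (f : cinf M) p : (- f) p = - f p. Proof. by []. Qed.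
Lemma cinfM (f g : cinf M) p : (f * g) p = f p * g p. Proof. by []. Qed.

Lemma smooth_cst (c : R) : (cst c : M -> R) \in @smooth_pred R n M.
Proof. by apply/asboolP => ? _ k; exact: Ck_cst. Qed.

Definition cinf_cst (c : R) : cinf M := Cinf (smooth_cst c).

End CinfTheory.

Section VectorFields.
Variables (R : realType) (n : nat) (M : manifold R n).

(* A vector field [X] is encoded by its action on functions: for each [p],
   [f |-> X f p] is a tangent vector at [p], i.e. a derivation at [p], and
   smoothness of [X] means that [X f] is smooth for every smooth [f]. *)
Definition derivation (X : cinf M -> cinf M) : Prop :=
  [/\ forall f g, X (f + g) = X f + X g,
      forall (c : R) f, X (cinf_cst M c * f) = cinf_cst M c * X f &
      forall f g, X (f * g) = f * X g + X f * g].

Definition derivation_pred : {pred cinf M -> (cinf M)^o} :=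
  fun X => `[< derivation X >].

Lemma derivation_lin (a : cinf M) (X Y Z : cinf M -> cinf M) :
  derivation X -> derivation Y ->
  (forall f p, Z f p = a p * X f p + Y f p) -> derivation Z.
Proof.
move=> [XD Xc XM] [YD Yc YM] E.
split=> [f g|c f|f g]; apply: cinfP => p; rewrite ?cinfD ?cinfM !E.
- by rewrite XD YD !cinfD; ring.
- by rewrite Xc Yc !cinfM; ring.
- by rewrite XM YM !cinfD !cinfM; ring.
Qed.

Lemma derivation_submod : submod_closed derivation_pred.
Proof.
split.
  apply/asboolP; split=> [f g|c f|f g] /=; apply: cinfP => p.
  - by rewrite -[RHS]/(0 + 0 : R) addr0.
  - by rewrite -[RHS]/(c * 0) mulr0.
  - by rewrite -[RHS]/(f p * 0 + 0 * g p) mulr0 mul0r addr0.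
move=> a X Y /asboolP dX /asboolP dY.
by apply/asboolP; apply: (derivation_lin dX dY).
Qed.

Record vfield := Vfield {
  vfield_fun :> cinf M -> (cinf M)^o; _ : vfield_fun \in derivation_pred }.

HB.instance Definition _ := [isSub for vfield_fun].
HB.instance Definition _ := [Choice of vfield by <:].
HB.instance Definition _ := GRing.SubChoice_isSubLmodule.Build (cinf M)
  (cinf M -> (cinf M)^o) derivation_pred vfield derivation_submod.

End VectorFields.

Section LieBracket.
Variables (R : realType) (n : nat) (M : manifold R n).
Implicit Types (X Y Z : vfield M) (f g : cinf M).

Lemma vfieldP X Y : (forall f, X f = Y f) -> X = Y.
Proof. by move=> XY; apply/val_inj/funext. Qed.

Lemma vfield_derivation X : derivation X.
Proof. exact/asboolP/(valP X). Qed.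

Lemma vfieldAE X Y f : (X + Y) f = X f + Y f. Proof. by []. Qed.
Lemma vfieldNE X f : (- X) f = - X f. Proof. by []. Qed.
Lemma vfieldZE (a : cinf M) X f : (a *: X) f = a * X f. Proof. by []. Qed.

Lemma vfield_eval X Y :
  (forall (e : vfield M -> R) (r : cinf M -> R), {morph e : Z T / Z + T} ->
     {morph e : Z / - Z} -> (forall a Z, e (a *: Z) = r a * e Z) ->
     e X = e Y) -> X = Y.
Proof.
move=> XY; apply: vfieldP => f; apply: cinfP => p.
exact: (XY (fun Z => Z f p) (fun a => a p)).
Qed.

Lemma vfieldD X f g : X (f + g) = X f + X g.
Proof. by case: (vfield_derivation X). Qed.

Lemma vfieldM X f g : X (f * g) = f * X g + X f * g.
Proof. by case: (vfield_derivation X). Qed.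

Lemma vfieldC X (c : R) f : X (cinf_cst M c * f) = cinf_cst M c * X f.
Proof. by case: (vfield_derivation X). Qed.

Lemma vfieldN X f : X (- f) = - X f.
Proof.
have -> (h : cinf M) : - h = cinf_cst M (-1) * h.
  by apply: cinfP => p; rewrite cinfM -[cinf_cst M (-1) p]/(-1) mulN1r.
by rewrite vfieldC; apply: cinfP => p;
  rewrite cinfM -[cinf_cst M (-1) p]/(-1) mulN1r.
Qed.

Lemma lie_bracket_subproof X Y :
  (fun f => X (Y f) - Y (X f)) \in @derivation_pred R n M.
Proof.
apply/asboolP; split=> [f g|c f|f g]; apply: cinfP => p.
- by rewrite !vfieldD !(cinfD, cinfN); ring.
- by rewrite !vfieldC !(cinfD, cinfN, cinfM); ring.
- by rewrite !(vfieldM, vfieldD) !(cinfD, cinfN, cinfM); ring.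
Qed.

Definition lie_bracket X Y : vfield M := Vfield (lie_bracket_subproof X Y).

Lemma lie_bracketE X Y f : lie_bracket X Y f = X (Y f) - Y (X f).
Proof. by []. Qed.

Lemma lie_bracketC X Y : lie_bracket X Y = - lie_bracket Y X.
Proof. by apply: vfieldP => f; rewrite vfieldNE !lie_bracketE opprB. Qed.

Lemma lie_bracketDr X Y Z :
  lie_bracket X (Y + Z) = lie_bracket X Y + lie_bracket X Z.
Proof.
apply: vfieldP => f; rewrite vfieldAE !lie_bracketE !vfieldAE vfieldD.
by apply: cinfP => p; rewrite !(cinfD, cinfN); ring.
Qed.

Lemma lie_bracketDl X Y Z :
  lie_bracket (X + Y) Z = lie_bracket X Z + lie_bracket Y Z.
Proof. by rewrite lie_bracketC lie_bracketDr opprD -!lie_bracketC. Qed.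

Lemma lie_bracketNr X Y : lie_bracket X (- Y) = - lie_bracket X Y.
Proof.
apply: vfieldP => f; rewrite vfieldNE !lie_bracketE !vfieldNE vfieldN.
by rewrite opprB opprK addrC.
Qed.

Lemma lie_bracketNl X Y : lie_bracket (- X) Y = - lie_bracket X Y.
Proof. by rewrite lie_bracketC lie_bracketNr -lie_bracketC. Qed.

Lemma lie_bracketZr X f Y :
  lie_bracket X (f *: Y) = f *: lie_bracket X Y + X f *: Y.
Proof.
apply: vfieldP => g; rewrite vfieldAE !vfieldZE !lie_bracketE !vfieldZE vfieldM.
by apply: cinfP => p; rewrite !(cinfD, cinfN, cinfM); ring.
Qed.

Lemma lie_bracket_cst X (c : R) Y :
  lie_bracket (cinf_cst M c *: X) Y = cinf_cst M c *: lie_bracket X Y.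
Proof.
apply: vfieldP => g; rewrite vfieldZE !lie_bracketE !vfieldZE vfieldC.
by rewrite mulrBr.
Qed.

Lemma lie_bracket_jacobi X Y Z : lie_bracket X (lie_bracket Y Z) +
  lie_bracket Y (lie_bracket Z X) + lie_bracket Z (lie_bracket X Y) = 0.
Proof.
apply: vfieldP => f; rewrite !vfieldAE !lie_bracketE !vfieldD !vfieldN.
apply: cinfP => p; rewrite !(cinfD, cinfN).
by rewrite -[RHS]/(0 : R); ring.
Qed.

End LieBracket.

Section AlternatingForms.
Variables (C : comPzRingType) (V : lmodType C) (k : nat).
Implicit Types (v : 'I_k -> V) (f : ('I_k -> V) -> C).

Definition upd v (i : 'I_k) (u : V) : 'I_k -> V :=
  fun j => if j == i then u else v j.

Definition multilinear f : Prop := forall v i (a : C) u w,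
  f (upd v i (a *: u + w)) = a * f (upd v i u) + f (upd v i w).

Definition alternating f : Prop :=
  forall v i j, i != j -> v i = v j -> f v = 0.

Definition altform_pred : {pred ('I_k -> V) -> C^o} :=
  fun f => `[< multilinear f /\ alternating f >].

Lemma altform_submod : submod_closed altform_pred.
Proof.
split.
  apply/asboolP; split=> [v i a u w|v i j _ _] //.
  by rewrite -[RHS]/(a * 0 + 0) mulr0 addr0.
move=> b f g /asboolP[lf af] /asboolP[lg ag]; apply/asboolP; split.
- move=> v i a u w.
  rewrite -[LHS]/(b * f (upd v i (a *: u + w)) + g (upd v i (a *: u + w))).
  rewrite lf lg -[RHS]/(a * (b * f (upd v i u) + g (upd v i u)) +
    (b * f (upd v i w) + g (upd v i w))).
  by rewrite !mulrDr !mulrA (mulrC b a) addrACA.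
- move=> v i j ij vij; rewrite -[LHS]/(b * f v + g v).
  by rewrite (af _ _ _ ij vij) (ag _ _ _ ij vij) mulr0 addr0.
Qed.

(* alternating C-multilinear maps V^k -> C *)
Record altform := Altform {
  altform_fun :> ('I_k -> V) -> C^o; _ : altform_fun \in altform_pred }.

HB.instance Definition _ := [isSub for altform_fun].
HB.instance Definition _ := [Choice of altform by <:].
HB.instance Definition _ := GRing.SubChoice_isSubLmodule.Build C
  (('I_k -> V) -> C^o) altform_pred altform altform_submod.

End AlternatingForms.

Section Tensors.
Variables (R : realType) (n : nat) (M : manifold R n).

(* [form k] is Omega^k(M) and [mvfield k] is the space of sections of the k-th
   exterior power of TM, whose elements are evaluated on k one-forms. *)
Definition form (k : nat) := altform (vfield M) k.
Definition mvfield (k : nat) := altform (form 1) k.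
HB.instance Definition _ k := GRing.Lmodule.on (form k).
HB.instance Definition _ k := GRing.Lmodule.on (mvfield k).

Definition app1 (xi : form 1) (X : vfield M) : cinf M := xi (fun=> X).

Lemma diff_subproof (f : cinf M) :
  (fun X : 'I_1 -> vfield M => X ord0 f) \in altform_pred (V := vfield M) (k := 1).
Proof.
apply/asboolP; split=> [v i a u w|v i j]; last by rewrite !ord1.
by rewrite /upd (ord1 i) eqxx.
Qed.

Definition diff_fun (f : cinf M) : form 1 := Altform (diff_subproof f).

Lemma wedge_subproof k (X : 'I_k -> vfield M) :
  (fun th : 'I_k -> form 1 => \det (\matrix_(i, j) app1 (th i) (X j)))
  \in altform_pred (V := form 1) (k := k).
Proof.
apply/asboolP; split=> [v i a u w|v i j ij vij].
  rewrite -[X in _ = _ + X]mul1r; apply: (@determinant_multilinear _ _ _ _ _ i).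
  - by apply/rowP => j; rewrite !mxE /upd eqxx mul1r.
  - by apply/matrixP=> l j; rewrite !mxE /upd eq_sym (negPf (neq_lift i l)).
  - by apply/matrixP=> l j; rewrite !mxE /upd eq_sym (negPf (neq_lift i l)).
by apply: (determinant_alternate ij) => l; rewrite !mxE vij.
Qed.

(* X_1 /\ ... /\ X_k *)
Definition wedge k (X : 'I_k -> vfield M) : mvfield k :=
  Altform (wedge_subproof X).

Definition nowhere_vanishing (V : lmodType (cinf M)) k (w : altform V k) : Prop :=
  forall p, exists v, w v p != 0.

(* the top exterior power of T^*M is a trivial line bundle *)
Definition orientable : Prop := exists mu : form n, nowhere_vanishing mu.

End Tensors.

Section LieAlgebroids.
Variables (R : realType) (n : nat) (M : manifold R n).

(* Lie algebroid structures on the vector bundle TM *)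
Record lie_algebroid := LieAlgebroid {
  bracket : vfield M -> vfield M -> vfield M;
  anchor : {linear vfield M -> vfield M};
  bracket_linear : forall (c : R) a b g,
    bracket (cinf_cst M c *: a + b) g =
    cinf_cst M c *: bracket a g + bracket b g;
  bracket_antisym : forall a b, bracket a b = - bracket b a;
  bracket_jacobi : forall a b g, bracket a (bracket b g) +
    bracket b (bracket g a) + bracket g (bracket a b) = 0;
  bracket_leibniz : forall a (f : cinf M) b,
    bracket a (f *: b) = f *: bracket a b + anchor a f *: b }.

Variable A : lie_algebroid.

Definition dA k (w : ('I_k -> vfield M) -> cinf M) :
    ('I_k.+1 -> vfield M) -> cinf M := fun a =>
  \sum_(i < k.+1) (-1) ^+ i * anchor A (a i) (w (fun l => a (lift i l))) +
  \sum_(i < k.+1) \sum_(j < k.+1 | (i < j)%N) (-1) ^+ (i + j) *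
    w (fun l : 'I_k => nth 0 (bracket A (a i) (a j) ::
      [seq a m | m <- enum 'I_k.+1 & (m != i) && (m != j)]) l).

Definition closed_form k (w : form M k) : Prop := forall a, dA w a = 0.

Definition exact_form k : form M k -> Prop :=
  match k with
  | 0 => fun w => w = 0
  | k'.+1 => fun w => exists s : form M k', forall a, w a = dA s a
  end.

(* H^k(A): the cosets of closed k-forms modulo exact ones *)
Record cohomology k := Cohomology {
  coset_of_class : set (form M k);
  coset_of_classP : exists2 w, closed_form w &
    coset_of_class = [set w' | exact_form (w' - w)] }.

Definition coh_class k (w : form M k) (hw : closed_form w) : cohomology k :=
  Cohomology (ex_intro2 _ _ w hw erefl).

(* [L] is the restriction to sections of the k-th exterior power of the
   derivation of the exterior algebra extending [bracket A a] on sections and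
   [f |-> anchor A a f] on functions. *)
Definition is_lie_derivation (a : vfield M) k
    (L : mvfield M k -> mvfield M k) : Prop :=
  [/\ forall P Q, L (P + Q) = L P + L Q,
      forall (f : cinf M) P, L (f *: P) = anchor A a f *: P + f *: L P &
      forall b : 'I_k -> vfield M,
        L (wedge b) = \sum_(i < k) wedge (upd b i (bracket A a (b i)))].

(* These conditions determine [L]: the set below has exactly one element, and
   the default value [0] is never used. *)
Definition lie_mvfield (a : vfield M) k (P : mvfield M k) : mvfield M k :=
  xget 0 [set L P | L in is_lie_derivation a (k := k)].

End LieAlgebroids.

Section ModularClass.
Variables (R : realType) (n : nat) (M : manifold R n).

Definition lie_form k (X : vfield M) (w : form M k) :
    ('I_k -> vfield M) -> cinf M := fun Y =>
  X (w Y) - \sum_(i < k) w (upd Y i (lie_bracket X (Y i))).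

(* Sections of the tensor product of the two line bundles are evaluated on
   pairs consisting of [n] one-forms and [n] vector fields. *)
Definition modular_cocycle (A : lie_algebroid M) (eta : mvfield M n)
    (mu : form M n) (xi : form M 1) : Prop :=
  forall (a : vfield M) (th : 'I_n -> form M 1) (Y : 'I_n -> vfield M),
    lie_mvfield A a eta th * mu Y + eta th * lie_form (anchor A a) mu Y =
    app1 xi a * (eta th * mu Y).

Definition is_modular_class (A : lie_algebroid M) (c : cohomology A 1) : Prop :=
  exists eta mu xi, [/\ nowhere_vanishing eta, nowhere_vanishing mu,
    modular_cocycle A eta mu xi & coset_of_class c xi].

End ModularClass.

Section Nijenhuis.
Variables (R : realType) (n : nat) (M : manifold R n).
(* A (1,1)-tensor, as a map linear over the ring of smooth functions. *)
Variable N : {linear vfield M -> vfield M}.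

Definition nijenhuis : Prop := forall X Y : vfield M,
  N (lie_bracket (N X) Y) + N (lie_bracket X (N Y)) - N (N (lie_bracket X Y))
  - lie_bracket (N X) (N Y) = 0.

Definition nij_bracket (X Y : vfield M) : vfield M :=
  lie_bracket (N X) Y + lie_bracket X (N Y) - N (lie_bracket X Y).

(* [X] and [th] restrict to dual bases of the tangent and cotangent spaces at
   [p]. *)
Definition dual_at (p : M) (X : 'I_n -> vfield M) (th : 'I_n -> form M 1) :=
  forall i j, app1 (th i) (X j) p = (i == j)%:R.

Definition is_trace (t : cinf M) : Prop := forall p X th, dual_at p X th ->
  t p = \tr (\matrix_(i, j) app1 (th i) (N (X j)) p).

(* the unique smooth function satisfying [is_trace] *)
Definition trace : cinf M := xget 0 [set t | is_trace t].

Hypothesis HN : nijenhuis.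

Local Notation lie := lie_bracket.

Lemma nijenhuisE X Y : N (nij_bracket X Y) = lie (N X) (N Y).
Proof. by have := HN X Y; rewrite raddfB raddfD => /subr0_eq. Qed.

Lemma nij_bracket_linear (c : R) X Y Z :
  nij_bracket (cinf_cst M c *: X + Y) Z =
  cinf_cst M c *: nij_bracket X Z + nij_bracket Y Z.
Proof.
rewrite /nij_bracket linearP !(lie_bracketDl, lie_bracket_cst) linearP.
by apply: vfield_eval => e r eD eN eZ; rewrite !(eD, eN, eZ); ring.
Qed.

Lemma nij_bracketC X Y : nij_bracket X Y = - nij_bracket Y X.
Proof.
rewrite /nij_bracket (lie_bracketC (N X)) (lie_bracketC X (N Y)).
rewrite (lie_bracketC X Y) raddfN.
by apply: vfield_eval => e r eD eN _; rewrite !(eD, eN); ring.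
Qed.

Lemma nij_bracket_leibniz X (f : cinf M) Y :
  nij_bracket X (f *: Y) = f *: nij_bracket X Y + N X f *: Y.
Proof.
rewrite /nij_bracket linearZ /= !lie_bracketZr linearD !linearZ /=.
by apply: vfield_eval => e r eD eN eZ; rewrite !(eD, eN, eZ); ring.
Qed.

Lemma nij_bracket_jacobi X Y Z : nij_bracket X (nij_bracket Y Z) +
  nij_bracket Y (nij_bracket Z X) + nij_bracket Z (nij_bracket X Y) = 0.
Proof.
have E U V W : nij_bracket U (nij_bracket V W) =
    lie (N U) (lie (N V) W) + lie (N U) (lie V (N W)) + lie U (lie (N V) (N W))
    - N (lie U (lie (N V) W) + lie U (lie V (N W)) + lie (N U) (lie V W))
    + N (N (lie U (lie V W))).
  have := HN U (lie V W).
  rewrite {1}/nij_bracket nijenhuisE /nij_bracket.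
  rewrite !(lie_bracketDr, lie_bracketNr, raddfD, raddfN) /=.
  move=> H; apply: vfield_eval => e r eD eN eZ.
  have e0 : e 0 = 0 by rewrite -[0](subrr 0) eD eN subrr.
  by move/(congr1 e): H; rewrite !(eD, eN) e0 => H; lra.
have J1 := lie_bracket_jacobi (N X) (N Y) Z.
have J2 := lie_bracket_jacobi X (N Y) (N Z).
have J3 := lie_bracket_jacobi (N X) Y (N Z).
have /(congr1 N) J4 := lie_bracket_jacobi X Y (N Z).
have /(congr1 N) J5 := lie_bracket_jacobi X (N Y) Z.
have /(congr1 N) J6 := lie_bracket_jacobi (N X) Y Z.
have /(congr1 (N \o N)) J7 := lie_bracket_jacobi X Y Z.
move: J4 J5 J6 J7; rewrite /= !raddf0 !E !raddfD => J4 J5 J6 J7.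
apply: vfield_eval => e r eD eN eZ.
have e0 : e 0 = 0 by rewrite -[0](subrr 0) eD eN subrr.
move: (congr1 e J1) (congr1 e J2) (congr1 e J3) (congr1 e J4) (congr1 e J5)
  (congr1 e J6) (congr1 e J7).
by rewrite !(eD, eN) e0 => *; lra.
Qed.

(* (TM, [.,.]_N, N) *)
Definition nijenhuis_algebroid : lie_algebroid M :=
  LieAlgebroid nij_bracket_linear nij_bracketC nij_bracket_jacobi
    nij_bracket_leibniz.

End Nijenhuis.

(* Main.v *)
Require Import Defs.
From HB Require Import structures.
From mathcomp Require Import all_boot all_order all_algebra fingroup perm.
From mathcomp Require Import all_classical all_reals all_analysis.
From mathcomp Require Import ring lra.
Set Implicit Arguments.
Unset Strict Implicit.
Unset Printing Implicit Defensive.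
Import Order.TTheory GRing.Theory Num.Theory.
Import numFieldNormedType.Exports.
Local Open Scope classical_set_scope.
Local Open Scope ring_scope.

(** Write L_X for the Lie derivative along X and t for the trace of N.  For
every X the bracket splits as [X,Y]_N = [NX,Y] + (L_X N) Y, and
(L_X N) Y = [X,NY] - N[X,Y] is linear in Y over the smooth functions.  On
multivector fields of top degree the Lie derivation of the algebroid is
therefore L_(NX) plus multiplication by tr (L_X N) = X t.  Take a volume form
mu and the multivector field eta dual to it.  If L_(NX) mu = d mu, then
L_(NX) eta = - d eta, these two terms cancel, and eta (x) mu has the modular
cocycle X |-> X t, which is dt.  Any other pair of trivialisations is
(f eta, g mu) with h = f g nowhere zero; it changes the cocycle by
(NX h) / h = NX (ln (h^2) / 2), an exact term.  This is
[modular_cocycle_multiple], with [exists_log_primitive] for the logarithm.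

That dt is closed for the algebroid differential uses the Nijenhuis identity in
the form L_(NX) N = N (L_X N).  Traces give NX t = tr (N (L_X N)) =
X (tr N^2) / 2, so the pullback of dt by N is an exact form in the ordinary
sense, and d_A (dt) is minus the ordinary differential of that pullback
([nijenhuis_trace_square], [dtrace_closed]).

Volume forms reduce the multilinear algebra to one principle: an alternating
map that vanishes on a frame vanishes on everything the frame spans
([altform_span_eq0]).  Hence all forms of top degree are multiples of mu
([top_quotient]); the trace of an endomorphism T is the function t with
mu (T Y_1, Y_2, ..) + .. + mu (.., T Y_n) = t mu (Y), and tr (L_X T) = X (tr T)
follows by differentiating that equation ([trace_of_lie_endo]).

Frames are where analysis enters, because vector fields are given as
derivations of the ring of smooth functions.  The lemma [exists_frame] provides,
around each point, global fields X_i and 1-forms th_i with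
rho Z = sum_i th_i(Z) X_i for every Z.  They are coordinate fields and
coordinate 1-forms multiplied by a bump function; that they span is Hadamard's
lemma, f = f(q) + sum_i (x_i - q_i) g_i with g_i smooth ([hadamard]), which also
yields the chain rule needed for changing charts ([Ck_comp]). *)

(** * Functions of class C^k on Euclidean space *)

Lemma is_derive_comp1 (R : realType) (W : normedModType R) (f : W -> R)
    (phi : R -> R) x v df dphi :
  is_derive x v f df -> is_derive (f x) 1 phi dphi ->
  is_derive x v (phi \o f) (dphi * df).
Proof.
move=> [f1 f2] [p1 p2].
have f1' := f1; move/derivable1P : f1' => /=; set h := fun t : R => _ => h1.
have h0 : h 0 = f x by rewrite /h scale0r add0r.
have E : (fun t : R => (phi \o f) (t *: v + x)) = phi \o h by [].
have D (F : W -> R) : 'D_v F x = derive1 (fun t : R => F (t *: v + x)) 0.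
  rewrite derive1E /derive; apply: (congr1 (fun u => lim (u @ 0^'))).
  by apply/funext => t; rewrite /= addr0 scale0r add0r [t *: 1]mulr1.
apply: DeriveDef.
  apply/derivable1P; rewrite E; apply/derivable1_diffP/differentiable_comp.
    exact/derivable1_diffP.
  by rewrite h0; apply/derivable1_diffP.
by rewrite D E derive1_comp ?h0 // -D f2 derive1E p2.
Qed.

Lemma is_derive_line (R : realType) (W : normedModType R) (F : W -> R) z v u d :
  is_derive (u *: v + z) v F d -> is_derive u 1 (fun s : R => F (s *: v + z)) d.
Proof.
have E : (fun h : R => h^-1 *: ((F \o shift (u *: v + z)) (h *: v) -
  F (u *: v + z))) =
  (fun h : R => h^-1 *: (((fun s : R => F (s *: v + z)) \o shift u) (h *: 1)
     - (fun s : R => F (s *: v + z)) u)).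
  by apply/funext => h; rewrite /= [h *: 1]mulr1 scalerDl addrA.
by case; rewrite /derivable /derive E.
Qed.

Section CkCalculus.
Variables (R : realType) (n : nat).
Implicit Types (U V : set 'rV[R]_n) (f g : 'rV[R]_n -> R).

Lemma CkS_is_derive k U f : open U ->
  (forall x, U x -> {for x, continuous f}) ->
  (forall i, exists2 fi, forall x, U x -> is_derive x (delta_mx 0 i) f (fi x) &
    Ck k U fi) -> Ck k.+1 U f.
Proof.
move=> oU cf df; split=> // i; have [fi dfi ci] := df i; split.
  by move=> x /dfi [].
by apply: Ck_ext ci => // x /set_mem /dfi [].
Qed.

Lemma Ck_continuous k U f : Ck k U f -> forall x, U x -> {for x, continuous f}.
Proof. by case: k => [|k] []. Qed.

Lemma CkS_Ck1 k U f : Ck k.+1 U f -> Ck 1 U f.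
Proof. by elim: k => // k IH /CkW. Qed.

Lemma Ck_is_derive k U f : Ck k.+1 U f -> forall x i, U x ->
  is_derive x (delta_mx 0 i) f ('D_(delta_mx 0 i) f x).
Proof. by move=> [_ df] x i Ux; apply: derivableP; exact: (df i).1. Qed.

Lemma Ck_subset k U V f : V `<=` U -> Ck k U f -> Ck k V f.
Proof.
move=> VU; elim: k f => [|k IH] f [cf df]; split=> //; try by move=> x /VU /cf.
by move=> i; have [d c] := df i; split; [move=> x /VU /d|exact: IH].
Qed.

(** The definition of C^k only speaks of partial derivatives at each point, so
a different neighbourhood may be used at each of them. *)
Lemma Ck_local k U f :
  (forall x, U x -> exists V, [/\ open V, V x & Ck k V f]) -> Ck k U f.
Proof.
elim: k f => [|k IH] f H.
  by split=> // x /H[V [_ Vx [cf _]]]; exact: cf.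
split=> [x /H[V [_ Vx [cf _]]]|i]; first exact: cf.
split=> [x /H[V [_ Vx [_ df]]]|]; first exact: (df i).1.
by apply: IH => x /H[V [oV Vx [_ df]]]; exists V; split=> //; exact: (df i).2.
Qed.

Lemma Ck_sum k U (I : Type) (r : seq I) (F : I -> 'rV[R]_n -> R) : open U ->
  (forall i, Ck k U (F i)) -> Ck k U (fun x => \sum_(i <- r) F i x).
Proof.
move=> oU CF; elim: r => [|i r IH].
  by apply: Ck_ext (Ck_cst k U 0) => // x _; rewrite big_nil.
by apply: Ck_ext (CkD oU (CF i) IH) => // x _; rewrite big_cons.
Qed.

(** The coordinate function is packed as a linear map, since linear maps are
their own differentials. *)
Lemma is_derive_coord (x : 'rV[R]_n) v (i : 'I_n) :
  is_derive x v (fun y : 'rV[R]_n => y 0 i) (v 0 i).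
Proof.
have df : differentiable (fun y : 'rV[R]_n => y 0 i) x
  by exact: differentiable_coord.
apply: DeriveDef; first exact: diff_derivable.
rewrite deriveE // (_ : 'd _ x = (fun y : 'rV[R]_n => y 0 i) :> (_ -> _)) //.
pose F := GRing.Linear.Pack (GRing.Linear.Class
   (GRing.isNmodMorphism.Build _ _ (fun y : 'rV[R]_n => y 0 i)
       (conj (mxE _ _ 0 i) (fun a b => mxE _ _ 0 i)))
   (GRing.isScalable.Build R _ _ _ (fun y : 'rV[R]_n => y 0 i)
       (fun a b => mxE _ _ 0 i))).
by apply: (@diff_lin _ _ _ F); exact: coord_continuous.
Qed.

Lemma Ck_coord k U (i : 'I_n) : open U -> Ck k U (fun y : 'rV[R]_n => y 0 i).
Proof.
move=> oU; case: k => [|k]; first by split=> // x _; exact: coord_continuous.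
apply: CkS_is_derive => // [x _|j]; first exact: coord_continuous.
exists (cst ((delta_mx 0 j : 'rV[R]_n) 0 i)); last exact: Ck_cst.
by move=> x _; exact: is_derive_coord.
Qed.

Lemma CkV k U f : open U -> (forall x, U x -> f x != 0) -> Ck k U f ->
  Ck k U (fun x => (f x)^-1).
Proof.
move=> oU f0; elim: k => [|k IH] Cf.
  split=> // x Ux; exact: (cvgV (f0 _ Ux) (Ck_continuous Cf Ux)).
apply: CkS_is_derive => // [x Ux|i].
  exact: (cvgV (f0 _ Ux) (Ck_continuous Cf Ux)).
have C1 := IH (CkW Cf); have [_ /(_ i)[df Cd]] := Cf.
exists (fun x => (- (f x) ^- 2) * ('D_(delta_mx 0 i) f x)).
  move=> x Ux; apply: DeriveDef; first by apply: derivableV;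
    [exact: f0|exact: df].
  by rewrite deriveV //; [exact: f0|exact: df].
apply: Ck_ext (CkM oU (CkB oU (Ck_cst k U 0) (CkM oU C1 C1)) Cd) => // x _.
by rewrite /= -[LHS]/((0 - (f x)^-1 * (f x)^-1) * _) sub0r -expr2 exprVn.
Qed.

Lemma Ck_ln k U f : open U -> (forall x, U x -> 0 < f x) -> Ck k U f ->
  Ck k U (fun x => ln (f x)).
Proof.
move=> oU f0 Cf.
have cl x : U x -> {for x, continuous (fun x => ln (f x))}.
  move=> Ux; apply: continuous_comp; first exact: (Ck_continuous Cf).
  exact: continuous_ln (f0 _ Ux).
case: k Cf => [|k] Cf; first by split.
apply: CkS_is_derive => // i; have [_ /(_ i)[df Cd]] := Cf.
exists (fun x => (f x)^-1 * ('D_(delta_mx 0 i) f x)).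
  move=> x Ux; apply: (@is_derive_comp1 _ _ f (@ln R)).
    by apply: derivableP; exact: df.
  exact: is_derive1_ln (f0 _ Ux).
apply: (CkM oU _ Cd); apply: CkV => //; last exact: CkW.
by move=> x /f0 /lt0r_neq0.
Qed.

End CkCalculus.

(** * Smooth bump functions *)

Section Flat.
Variable R : realType.

(** The family t^-m exp(-1/t), extended by 0 for t <= 0, is closed under
differentiation up to linear combinations.  All members are therefore handled
by a single induction on the order of differentiability. *)
Definition flat (m : nat) (t : R) : R :=
    if 0 < t then t ^- m * expR (- t^-1) else 0.

(** With u = 1/t this is u^(m+2) <= (m+2)! exp u, one term of the exponential
series.  A quadratic bound is what makes the derivative at 0 vanish. *)
Lemma flat_le m t : `|flat m t| <= (m.+2)`!%:R * t ^+ 2.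
Proof.
rewrite /flat; case: ifPn => t0; last first.
  by rewrite normr0 mulr_ge0 ?sqr_ge0.
have u0 : 0 < t^-1 by rewrite invr_gt0.
rewrite ger0_norm; last by rewrite mulr_ge0 ?expR_ge0 // invr_ge0 exprn_ge0 //
  ltW.
rewrite expRN -exprVn.
have := expR_ge1Dxn m.+1 (ltW u0).
move: (expR _) (expR_gt0 t^-1) => E E0 H.
have {}H : t^-1 ^+ m.+2 / (m.+2)`!%:R <= E by apply: le_trans H; rewrite lerDr.
rewrite ler_pdivrMr ?ltr0n ?fact_gt0 // in H.
rewrite ler_pdivrMr //.
have -> : t^-1 ^+ m = t^-1 ^+ m.+2 * t ^+ 2.
  by rewrite exprS exprS; field; rewrite gt_eqF.
by rewrite [leRHS]mulrAC ler_wpM2r ?sqr_ge0 // mulrC.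
Qed.

Lemma flat_gt0 m t : 0 < t -> 0 < flat m t.
Proof.
by move=> t0; rewrite /flat t0 mulr_gt0 ?expR_gt0 // invr_gt0 exprn_gt0.
Qed.

Lemma flat_le0 m t : t <= 0 -> flat m t = 0.
Proof. by rewrite /flat leNgt; case: (0 < t). Qed.

Lemma is_derive_flat (m : nat) (t : R) :
  is_derive t 1 (flat m) (flat m.+2 t - m%:R * flat m.+1 t).
Proof.
have [t0|t0|t0] := ltgtP t 0.
- rewrite !flat_le0 ?ltW // mulr0 subr0.
  apply: near_eq_is_derive (is_derive_cst 0 t 1).
  near=> s; rewrite /cst flat_le0 // ltW //; near: s.
  exact: lt_nbhsl.
- have tn0 : t != 0 by rewrite gt_eqF.
  have E : \forall s \near t, s ^- m * expR (- s^-1) = flat m s.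
    by near=> s; rewrite /flat ifT //; near: s; exact: lt_nbhsr.
  apply: near_eq_is_derive E _.
  have d1 : is_derive t 1 (fun s : R => s ^- m) (- (t ^+ m) ^- 2 *
    (m%:R * t ^+ m.-1)).
    have dm : is_derive t 1 (fun s : R => s ^+ m) (m%:R * t ^+ m.-1).
      apply: DeriveDef; first exact: exprn_derivable.
      by rewrite exp_derive [LHS]mulr1.
    have tm : t ^+ m != 0 by rewrite expf_neq0.
    case: dm => dm1 dm2; apply: DeriveDef; first exact: derivableV.
    by rewrite deriveV // dm2.
  have d2 : is_derive t 1 (fun s : R => expR (- s^-1)) (expR (- t^-1) * t ^- 2).
    have di : is_derive t 1 (fun s : R => - s^-1) (t ^- 2).
      have dV : is_derive t 1 (fun s : R => s^-1) (- t ^- 2).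
        apply: DeriveDef; first by apply: (@derivableV _ _ id).
        by rewrite (@deriveV _ _ id) // derive_id scaleNr [_ *: _]mulr1.
      by have := is_deriveN dV; rewrite opprK.
    by apply: (@is_derive_comp1 _ _ (fun s : R => - s^-1) expR) => //;
      by apply: DeriveDef; [exact: derivable_expR|rewrite derive_expR].
  apply: is_derive_eq (is_deriveM d1 d2) _.
  rewrite /flat t0 /GRing.scale /=.
  move: (expR _) => E.
  by case: (m) => [|k]; rewrite ?exprS /=; field; rewrite ?expf_neq0 ?tn0.
- rewrite t0 !flat_le0 // mulr0 subr0.
  have C : h^-1 *: ((flat m (h *: 1 + 0) - flat m 0) : R) @[h --> 0^'] -->
    (0 : R).
    apply/cvgr0Pnorm_le => e e0; near=> h.
    rewrite [flat m 0]flat_le0 // subr0 addr0 [h *: 1]mulr1 normrM normfV.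
    have h0 : h != 0 by near: h; exact: nbhs_dnbhs_neq.
    have hp : 0 < `|h| by rewrite normr_gt0.
    rewrite -(ler_pM2l hp) mulrA divff ?gt_eqF // mul1r.
    apply: le_trans (flat_le m h) _.
    have hC : `|h| <= e / (m.+2)`!%:R by near: h; apply: dnbhs0_le;
      rewrite divr_gt0 // ltr0n fact_gt0.
    rewrite -[h ^+ 2]real_normK ?num_real // expr2 mulrCA ler_pM2l // mulrC.
    by rewrite -ler_pdivlMr // ltr0n fact_gt0.
  apply: DeriveDef; first by apply/cvg_ex; exists 0.
  exact/cvg_lim.
Unshelve. all: by end_near.
Qed.
End Flat.

Section Bump.
Variables (R : realType) (n : nat).
Implicit Types (U V : set 'rV[R]_n) (f g : 'rV[R]_n -> R).

Lemma Ck_flat k m U f : open U -> Ck k U f -> Ck k U (fun x => flat m (f x)).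
Proof.
move=> oU Cf.
have cflat p (t : R) : {for t, continuous (flat p)}.
  apply/differentiable_continuous/derivable1_diffP.
  by have [] := is_derive_flat p t.
elim: k m Cf => [|k IH] m Cf.
  by split=> // x Ux; apply: continuous_comp;
    [exact: (Ck_continuous Cf)|exact: cflat].
apply: CkS_is_derive => // [x Ux|i].
  by apply: continuous_comp; [exact: (Ck_continuous Cf)|exact: cflat].
have [_ /(_ i)[df Cd]] := Cf; have C1 := IH _ (CkW Cf).
exists (fun x => (flat m.+2 (f x) - m%:R * flat m.+1 (f x)) *
  'D_(delta_mx 0 i) f x).
  move=> x Ux; apply: (@is_derive_comp1 _ _ f); last exact: is_derive_flat.
  by apply: derivableP; exact: df.
apply: (CkM oU _ Cd); apply: (CkB oU (C1 _)).
exact: (CkM oU (Ck_cst k U m%:R) (C1 _)).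
Qed.

(** Normalised to 1 at the centre; the Euclidean ball in which it is nonzero
lies in the ball of the same radius for the sup norm. *)
Definition smooth_bump (a : 'rV[R]_n) (r : R) (x : 'rV[R]_n) : R :=
  flat 0 (r ^+ 2 - \sum_i (x 0 i - a 0 i) ^+ 2) / flat 0 (r ^+ 2).

Lemma Ck_smooth_bump k a r U : open U -> Ck k U (smooth_bump a r).
Proof.
move=> oU; apply: (CkM oU _ (Ck_cst k U _)); apply: Ck_flat => //.
apply: (CkB oU (Ck_cst k U _)); apply: Ck_sum => // i.
have C : Ck k U (fun x => x 0 i - a 0 i).
  by apply: (CkB oU _ (Ck_cst k U _)); exact: Ck_coord.
by apply: Ck_ext (CkM oU C C) => // x _; rewrite expr2.
Qed.

Lemma smooth_bump_center a r : 0 < r -> smooth_bump a r a = 1.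
Proof.
move=> r0; rewrite /smooth_bump big1; last by move=> i _; rewrite subrr expr0n.
by rewrite subr0 divff // gt_eqF // flat_gt0 // exprn_gt0.
Qed.

Lemma smooth_bump_out a r x : 0 < r -> smooth_bump a r x != 0 -> ball a r x.
Proof.
move=> r0 bx; have {bx} : 0 < r ^+ 2 - \sum_i (x 0 i - a 0 i) ^+ 2.
  by move: bx; apply: contraR; rewrite -leNgt /smooth_bump => /flat_le0 ->;
    rewrite mul0r.
rewrite subr_gt0 => lt; split=> // i j; rewrite ord1 /ball /=.
rewrite -(@ltr_pXn2r _ 2) // ?nnegrE ?normr_ge0 // ?ltW //.
apply: le_lt_trans lt; rewrite real_normK ?num_real // (bigD1 j) //= -sqrrN
  opprB.
by rewrite lerDl sumr_ge0 // => l _; exact: sqr_ge0.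
Qed.

End Bump.

(** * Hadamard's lemma and the chain rule *)

Lemma cvg_rV (R : realType) (n : nat) T (F : set_system T)
    {FF : Filter F} (f : T -> 'rV[R]_n) (l : 'rV[R]_n) :
  (forall i, (f x 0 i) @[x --> F] --> l 0 i) -> f @ F --> l.
Proof.
move=> H; apply/cvg_ballP => e e0.
have : \forall x \near F, forall j : 'I_n, ball (l 0 j) e (f x 0 j).
  by apply: filter_forall => j; move/cvg_ballP: (H j); apply.
by apply: filterS => x Hx; split=> // i j; rewrite ord1; exact: Hx.
Qed.

Lemma Rintegral01_cst (R : realType) (C : R) :
  \int[@lebesgue_measure R]_(t in `[0, 1]) C = C.
Proof.
have m1 : fine ((@lebesgue_measure R) `[0, 1]) = 1.
  by rewrite lebesgue_measure_itv /= lte_fin ltr01 /= oppr0 addr0.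
by rewrite Rintegral_cst // [X in C * X]m1 mulr1.
Qed.

Section CoordinateScaling.
Variables (R : realType) (n : nat) (a : 'rV[R]_n) (r : R) (c : 'I_n -> R -> R).
Hypothesis c_cont : forall i, continuous (c i).
Hypothesis c01 : forall i t, 0 <= t <= 1 -> 0 <= c i t <= 1.
Local Notation B := (ball a r).

(** Each coordinate is contracted towards that of [a] by its own factor.  Since
the map is diagonal, partial derivatives of a composite with it are again
partial derivatives, and the chain rule in several variables can be derived
from what follows instead of being presupposed. *)
Definition coord_scale (t : R) (x : 'rV[R]_n) : 'rV[R]_n :=
  \row_l (a 0 l + c l t * (x 0 l - a 0 l)).

Lemma coord_scale_ball t x : 0 <= t <= 1 -> B x -> B (coord_scale t x).
Proof.
move=> t01 [r0 Bx]; split=> // i j; have := Bx 0 j; rewrite !ord1 /ball /= mxE.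
have /andP[c0 c1] := c01 j t01.
rewrite opprD addrA subrr add0r normrN normrM distrC; apply: le_lt_trans.
by rewrite ger0_norm // ler_piMl.
Qed.

Lemma coord_scale_cvg t0 x :
  (coord_scale p.1 p.2) @[p --> (t0, x)] --> coord_scale t0 x.
Proof.
apply: cvg_rV => i; rewrite /coord_scale mxE.
under eq_fun do rewrite mxE.
apply: cvgD; first exact: cvg_cst.
apply: cvgM.
  apply: (@cvg_comp _ _ _ (fun p : R * 'rV[R]_n => p.1) (c i) _ (nbhs t0)).
    exact: cvg_fst.
  exact: c_cont.
apply: cvgB; last exact: cvg_cst.
apply: (@cvg_comp _ _ _ (fun p : R * 'rV[R]_n => p.2) (fun y =>
  y 0 i) _ (nbhs x)).
  exact: cvg_snd.
exact: coord_continuous.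
Qed.

Lemma coord_scale_delta t x l h :
  coord_scale t (h *: delta_mx 0 l + x) = (c l t * h) *: delta_mx 0 l +
    coord_scale t x.
Proof.
apply/rowP => i; rewrite !mxE eqxx /=.
by case: eqVneq => [->|_]; rewrite ?mulr1 ?mulr0 ?add0r //; ring.
Qed.

(** Continuity in both variables is uniform over the compact range of t. *)
Lemma coord_scale_uniform (w : R -> R) (F : 'rV[R]_n -> R) x e :
  continuous w -> (forall y, B y -> {for y, continuous F}) -> B x -> 0 < e ->
  \forall y \near x, forall t, 0 <= t <= 1 ->
    `|w t * F (coord_scale t y) - w t * F (coord_scale t x)| < e.
Proof.
move=> cw cF Bx e0.
have /compact_near_coveringP H := @segment_compact R 0 1.
pose P y t := `|w t * F (coord_scale t y) - w t * F (coord_scale t x)| < e.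
have {}H : \forall y \near x, `[0, 1]%classic `<=` P y.
  apply: (H _ (nbhs x) P) => t0 /=; rewrite in_itv /= => t01.
  have C : (w p.1 * F (coord_scale p.1 p.2)) @[p --> (t0, x)] -->
    w t0 * F (coord_scale t0 x).
    apply: cvgM.
      apply: (@cvg_comp _ _ _ (fun p : R * 'rV[R]_n => p.1) w _ (nbhs t0)).
        exact: cvg_fst.
      exact: cw.
    apply: (@cvg_comp _ _ _ (fun p => coord_scale p.1 p.2) F _
      (nbhs (coord_scale t0 x))).
      exact: coord_scale_cvg.
    by apply: cF; exact: coord_scale_ball.
  have e2 : 0 < e / 2 by lra.
  move/cvgrPdist_lt: C => /(_ _ e2) [[U1 U2] /= [U1t U2x] HU].
  exists (U1, U2) => // -[t y] /= [U1t' U2y].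
  have h1 := HU (t, x) (conj U1t' (nbhs_singleton U2x)).
  have h2 := HU (t, y) (conj U1t' U2y).
  rewrite /= in h1 h2.
  rewrite /P; move: h1 h2; rewrite !ltr_norml => /andP[? ?] /andP[? ?].
  by apply/andP; split; lra.
apply: filterS H => y Hy t t01; apply: Hy.
by rewrite /= in_itv.
Qed.

Local Notation mu := (@lebesgue_measure R).
Implicit Types (w : R -> R) (F : 'rV[R]_n -> R).

Definition scaling_integral w F (x : 'rV[R]_n) : R :=
  \int[mu]_(t in `[0, 1]) (w t * F (coord_scale t x)).

Lemma coord_scale_within_continuous w F x : continuous w ->
  (forall y, B y -> {for y, continuous F}) -> B x ->
  {within `[0, 1], continuous (fun t => w t * F (coord_scale t x))}.
Proof.
move=> cw cF Bx; apply: continuous_in_subspaceT => t;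
  rewrite inE /= in_itv /= => t01.
apply: cvgM; first exact: cw.
apply: (@cvg_comp _ _ _ (fun s => coord_scale s x) F _
  (nbhs (coord_scale t x))).
  apply: cvg_rV => i; rewrite /coord_scale mxE; under eq_fun do rewrite mxE.
  apply: cvgD; first exact: cvg_cst.
  by apply: cvgM; [exact: c_cont|exact: cvg_cst].
by apply: cF; exact: coord_scale_ball.
Qed.

Lemma coord_scale_integrable w F x : continuous w ->
  (forall y, B y -> {for y, continuous F}) -> B x ->
  mu.-integrable `[0, 1] (EFin \o (fun t => w t * F (coord_scale t x))).
Proof.
move=> cw cF Bx; apply: continuous_compact_integrable;
  first exact: segment_compact.
exact: coord_scale_within_continuous.
Qed.

Lemma scaling_integral_continuous w F x : continuous w ->
  (forall y, B y -> {for y, continuous F}) -> B x ->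
    {for x, continuous (scaling_integral w F)}.
Proof.
move=> cw cF Bx /=; apply: (@cvgrPdist_le _ _ _ (nbhs x) _ _ _).2 => e e0.
have Hu := coord_scale_uniform cw cF Bx e0.
have oB : \forall y \near x, B y by apply: open_nbhs_nbhs; split => //;
  exact: ball_open.
near=> y.
have By : B y by near: y.
have m01 : measurable (`[0, 1]%classic : set R) by [].
have iy := coord_scale_integrable cw cF By;
  have ix := coord_scale_integrable cw cF Bx.
have ib : mu.-integrable `[0, 1]
  (EFin \o (fun t => w t * F (coord_scale t y) - w t * F (coord_scale t x))).
  by apply: eq_integrable (integrableB _ iy ix) => // t _; rewrite /= EFinB.
rewrite distrC /scaling_integral -RintegralB //.
apply: le_trans; first exact: le_normr_Rintegral.
apply: (@le_trans _ _ (\int[mu]_(t in `[0, 1]) e)).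
  apply: le_Rintegral => //.
  - apply: integrable_norm.
    exact: ib.
  - apply: continuous_compact_integrable; first exact: segment_compact.
    by apply: continuous_subspaceT => t; exact: cvg_cst.
  - move=> t /=; rewrite in_itv /= => t01; apply: ltW.
    by move: t t01; near: y.
by rewrite [leLHS](Rintegral01_cst e).
Unshelve. all: by end_near.
Qed.

(** Differentiation under the integral sign: along one axis the integrand has
derivative w(t) c_l(t) times a partial derivative of F, so the result is again
an integral of the same kind, with weight w c_l. *)
Lemma scaling_integral_is_derive w F x l : continuous w -> Ck 1 B F -> B x ->
  is_derive x (delta_mx 0 l) (scaling_integral w F)
    (scaling_integral (w \* c l) ('D_(delta_mx 0 l) F) x).
Proof.
move=> cw CF Bx; set e := delta_mx 0 l; set D := 'D_e F.
have cF := Ck_continuous CF.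
have cD y : B y -> {for y, continuous D} by have [_ /(_ l) [_ [cD _]]] := CF;
  exact: cD.
have dF y : B y -> is_derive y e F (D y) by move=> By; exact: (Ck_is_derive CF).
have cwc : continuous (w \* c l) by move=> t; apply: cvgM;
  [exact: cw|exact: c_cont].
have Hu := coord_scale_uniform cwc cD Bx ltr01.
have oB : \forall y \near x, B y by apply: open_nbhs_nbhs; split => //;
  exact: ball_open.
have cl : (fun h : R => h *: e + x) @ (0 : R) --> x.
  have : (fun h : R => h *: e + x) @ (0 : R) --> 0 *: e + x.
    by apply: cvgD; [apply: cvgZr_tmp; exact: cvg_id|exact: cvg_cst].
  by rewrite scale0r add0r.
(* on a short segment around x the derivative stays within 1 of its value at
   x, which is bounded by M: the constant M + 1 dominates *)
have [d /= d0 Hd] : \forall h \near (0 : R), B (h *: e + x) /\ forall t, 0 <=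
  t <= 1 ->
    `|(w \* c l) t * D (coord_scale t (h *: e + x)) - (w \* c l) t *
      D (coord_scale t x)| < 1.
  apply: (cl (fun y => B y /\ forall t, 0 <= t <= 1 ->
    `|(w \* c l) t * D (coord_scale t y) - (w \* c l) t *
      D (coord_scale t x)| < 1)).
  exact: filterI.
have m01 : measurable (`[0, 1]%classic : set R) by [].
have [M HM] : exists M, forall t, 0 <= t <= 1 ->
  `|(w \* c l) t * D (coord_scale t x)| <= M.
  have [|t0 _ Ht0] := @EVT_max R (fun t =>
    `|(w \* c l) t * D (coord_scale t x)|) 0 1 ler01.
    move=> t; apply: cvg_norm; exact: (coord_scale_within_continuous cwc cD Bx).
  by exists `|(w \* c l) t0 * D (coord_scale t0 x)| => t t01; apply: Ht0;
    rewrite in_itv.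
pose f (h t : R) := w t * F (coord_scale t (h *: e + x)).
have inI h : `]- d, d[%classic h -> `|0 - h| < d.
  by rewrite /= in_itv /= sub0r normrN ltr_norml.
have df h t : `]- d, d[%classic h -> `[0, 1]%classic t ->
    is_derive h 1 (f ^~ t) ((w \* c l) t * D (coord_scale t (h *: e + x))).
  move=> /inI /Hd [By _] /=; rewrite in_itv /= => t01.
  have := coord_scale_ball t01 By; rewrite coord_scale_delta => By'.
  have dl : is_derive h 1 (fun u : R => c l t * u) (c l t).
    by apply: is_derive_eq (is_deriveZ (c l t) (is_derive_id h 1)) _;
      rewrite [LHS]mulr1.
  have := is_derive_comp1 dl (is_derive_line (dF _ By')).
  move=> dc; rewrite /f; under eq_fun do rewrite coord_scale_delta.
  apply: is_derive_eq (is_deriveZ (w t) dc) _.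
  by rewrite -[LHS]/(w t * (_ * c l t)) mulrCA mulrC.
have p1 h t : `]- d, d[%classic h -> `[0, 1]%classic t ->
   partial1of2 f h t = ((w \* c l) t * D (coord_scale t (h *: e + x))).
  by move=> Ih It; rewrite partial1of2E; have [_ ->] := df h t Ih It.
have I0 : `]- d, d[%classic (0 : R) by rewrite /= in_itv /= oppr_lt0 d0.
have C := @cvg_differentiation_under_integral R _ _ mu f _ m01 0 (- d) d I0 _ _
  (cst (M + 1)).
have {}C : (h^-1 *: (scaling_integral w F (h *: e + x) -
  scaling_integral w F x)) @[h --> 0^'] -->
    scaling_integral (w \* c l) D x.
  have -> : scaling_integral (w \* c l) D x =
    \int[mu]_(t in `[0, 1]) partial1of2 f 0 t.
    apply: eq_Rintegral => t /set_mem It.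
    by rewrite p1 // scale0r add0r.
  have -> : (fun h : R => h^-1 *: (scaling_integral w F (h *: e + x) -
    scaling_integral w F x)) =
     (fun h : R => h^-1 *: ((fun x' => \int[mu]_(y in `[0, 1]) f x' y) (h + 0)
           - (fun x' => \int[mu]_(y in `[0, 1]) f x' y) 0)).
    by apply/funext => h; rewrite /= addr0 /f scale0r add0r.
  apply: C.
  - by move=> h /inI /Hd [By _]; exact: coord_scale_integrable.
  - by move=> h t Ih It; have [] := df h t Ih It.
  - move=> t; rewrite /= addr_ge0 //; have := HM 0; rewrite lexx ler01.
    by move=> /(_ isT); apply: le_trans.
  - apply: continuous_compact_integrable; first exact: segment_compact.
    by apply: continuous_subspaceT => t; exact: cvg_cst.
  - move=> h t Ih It; rewrite p1 //=.
    have [By] := Hd _ (inI _ Ih).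
    have t01 : 0 <= t <= 1 by move: It; rewrite /= in_itv.
    move=> /(_ t t01) lt1; have := HM t t01.
    rewrite -(subrK ((w \* c l) t * D (coord_scale t x))
      (_ * D (coord_scale t (h *: e + x)))).
    move=> leM; rewrite addrC; apply: le_trans (ler_normD _ _) _.
    by apply: lerD => //; exact: ltW.
apply: DeriveDef; first by apply/cvg_ex; eexists; exact: C.
exact/cvg_lim.
Qed.

End CoordinateScaling.

(** The weight is quantified inside the induction because differentiation
multiplies it by one of the scaling factors. *)
Lemma Ck_scaling_integral (R : realType) (n : nat) (a : 'rV[R]_n) (r : R)
    (c : 'I_n -> R -> R) k w F :
  (forall i, continuous (c i)) ->
  (forall i t, 0 <= t <= 1 -> 0 <= c i t <= 1) ->
  continuous w -> Ck k (ball a r) F ->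
    Ck k (ball a r) (scaling_integral a c w F).
Proof.
move=> cc c01; elim: k w F => [|k IH] w F cw CF.
  by split=> // x Bx; apply: (scaling_integral_continuous cc c01 cw _ Bx);
    exact: (Ck_continuous CF).
apply: CkS_is_derive; first exact: ball_open.
  by move=> x Bx; apply: (scaling_integral_continuous cc c01 cw _ Bx);
    exact: (Ck_continuous CF).
move=> i; exists (scaling_integral a c (w \* c i) ('D_(delta_mx 0 i) F)).
  by move=> x Bx; exact: (scaling_integral_is_derive cc c01 i cw (CkS_Ck1 CF)
    Bx).
apply: IH; last by have [_ /(_ i) []] := CF.
by move=> t; apply: cvgM; [exact: cw|exact: cc].
Qed.

Section Hadamard.
Variables (R : realType) (n : nat) (a : 'rV[R]_n) (r : R).
Local Notation B := (ball a r).
Local Notation mu := (@lebesgue_measure R).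
Implicit Types (F : 'rV[R]_n -> R) (x : 'rV[R]_n).

(** The segment from the point where coordinates 0, .., i-1 are those of [a] to
the point where coordinate i is also that of [a], run backwards in t.  These n
segments form a path parallel to the axes from x to [a]. *)
Definition segment_scaling (i l : 'I_n) (t : R) : R :=
  if (l < i)%N then 0 else if l == i then t else 1.

Lemma segment_scaling_continuous i l : continuous (segment_scaling i l).
Proof.
rewrite /segment_scaling; case: (l < i)%N => [t|]; first exact: cvg_cst.
by case: (l == i) => t; [exact: cvg_id|exact: cvg_cst].
Qed.

Lemma segment_scaling01 i l t : 0 <= t <= 1 -> 0 <= segment_scaling i l t <= 1.
Proof.
rewrite /segment_scaling; case: ifP => _; first by lra.
by case: ifP => // _; lra.
Qed.

Definition hadamard_coef F (i : 'I_n) : 'rV[R]_n -> R :=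
  scaling_integral a (segment_scaling i) (cst 1) ('D_(delta_mx 0 i) F).

Lemma Ck_hadamard_coef k F i : Ck k.+1 B F -> Ck k B (hadamard_coef F i).
Proof.
move=> [_ /(_ i) [_ CF]]; apply: Ck_scaling_integral => //.
- exact: segment_scaling_continuous.
- exact: segment_scaling01.
- by move=> t; exact: cvg_cst.
Qed.

Lemma hadamard_coef_center F i : hadamard_coef F i a = 'D_(delta_mx 0 i) F a.
Proof.
rewrite /hadamard_coef /scaling_integral -[RHS]Rintegral01_cst.
apply: eq_Rintegral => t _; rewrite /= mul1r; congr ('D__ F _).
by apply/rowP => l; rewrite mxE subrr mulr0 addr0.
Qed.

(** The fundamental theorem of calculus on one segment of the path. *)
Lemma hadamard_segment F i x : Ck 1 B F -> B x ->
  (x 0 i - a 0 i) * hadamard_coef F i x =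
  F (coord_scale a (segment_scaling i) 1 x) -
    F (coord_scale a (segment_scaling i) 0 x).
Proof.
move=> CF Bx; set c := segment_scaling i; set D := 'D_(delta_mx 0 i) F.
have cc := @segment_scaling_continuous i; have c01 := @segment_scaling01 i.
have cD y : B y -> {for y, continuous D} by have [_ /(_ i) [_ [cD _]]] := CF;
  exact: cD.
have cst1 : continuous (cst 1 : R -> R) by move=> t; exact: cvg_cst.
have E t : coord_scale a c t x = (t * (x 0 i - a 0 i)) *: delta_mx 0 i +
  coord_scale a c 0 x.
  apply/rowP => l; rewrite !mxE eqxx /= /c /segment_scaling.
  case: ltngtP => [li|il|/val_inj ->].
  - by rewrite !(gtn_eqF, ltn_eqF, mulr0, mul0r, add0r, addr0) // -val_eqE /=
    ltn_eqF // mulr0 add0r.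
  - by rewrite -val_eqE /= gtn_eqF // mulr0 add0r.
  - by rewrite eqxx /= mulr1n; ring.
pose h t := F (coord_scale a c t x).
pose dh t := (x 0 i - a 0 i) * (cst 1 t * D (coord_scale a c t x)).
have dhP (t : R) : 0 <= t <= 1 -> is_derive t 1 h (dh t).
  move=> t01; have By := coord_scale_ball c01 t01 Bx.
  rewrite E in By.
  have dF := Ck_is_derive CF i By.
  have dl : is_derive t 1 (fun u : R => (x 0 i - a 0 i) * u) (x 0 i - a 0 i).
    by apply: is_derive_eq (is_deriveZ _ (is_derive_id t 1)) _;
      rewrite [LHS]mulr1.
  rewrite mulrC in dF.
  have Eh : h = (fun u => F (((x 0 i - a 0 i) * u) *: delta_mx 0 i +
    coord_scale a c 0 x)).
    by apply/funext => u; rewrite /h E mulrC.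
  rewrite Eh; apply: is_derive_eq (is_derive_comp1 dl (is_derive_line dF)) _.
  by rewrite /dh /= mul1r mulrC [in RHS]E [t * _]mulrC.
have ch (t : R) : 0 <= t <= 1 -> {for t, continuous h}.
  move=> t01; apply/differentiable_continuous/derivable1_diffP.
  by have [] := dhP t t01.
have := @continuous_FTC2 R dh h 0 1 ltr01.
move=> /(_ _ _ _)/(congr1 fine) => FTC.
rewrite /hadamard_coef /scaling_integral -RintegralZl //; last first.
  exact: (coord_scale_integrable cc c01 cst1 cD Bx).
rewrite -[RHS]/(h 1 - h 0) -[LHS]/(fine (\int[mu]_(t in `[0, 1]) (dh t)%:E))
  FTC //.
- move=> t; apply: cvgM; first exact: cvg_cst.
  exact: (coord_scale_within_continuous cc c01 cst1 cD Bx).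
- split.
  + move=> t; rewrite in_itv /= => /andP[/ltW ? /ltW ?].
    by have [] := dhP t; rewrite ?andbT; first exact/andP.
  + by apply: cvg_at_right_filter; apply: ch; rewrite lexx ler01.
  + by apply: cvg_at_left_filter; apply: ch; rewrite lexx ler01.
- move=> t; rewrite in_itv /= => /andP[/ltW ? /ltW ?].
  by rewrite derive1E; have [] := dhP t; first exact/andP.
Qed.

(** The increments along the segments telescope. *)
Lemma hadamard F x : Ck 1 B F -> B x ->
  F x = F a + \sum_i (x 0 i - a 0 i) * hadamard_coef F i x.
Proof.
move=> CF Bx; apply/eqP; rewrite addrC -subr_eq; apply/eqP.
pose P k : 'rV[R]_n := \row_l (if (l < k)%N then a 0 l else x 0 l).
transitivity (F (P 0) - F (P n)).
  congr (F _ - F _); apply/rowP => l; rewrite mxE //.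
  by rewrite ltn_ord.
rewrite -opprB -(telescope_sumr (fun k => F (P k))) // big_mkord -sumrN.
apply: eq_bigr => i _; rewrite opprB hadamard_segment //.
congr (F _ - F _); apply/rowP => l; rewrite !mxE /segment_scaling ?ltnS.
  by case: (ltnP l i) => li; rewrite ?mul0r ?addr0 //; case: ifP => _;
    rewrite mul1r addrC subrK.
case: (ltngtP l i) => [li|il|/val_inj ->]; first by rewrite mul0r addr0.
  by rewrite -val_eqE /= gtn_eqF // mul1r addrC subrK.
by rewrite eqxx mul0r addr0.
Qed.

End Hadamard.

Section ChainRule.
Variables (R : realType) (m n : nat).
Implicit Types (U : set 'rV[R]_m) (V : set 'rV[R]_n) (F : 'rV[R]_n -> R)
  (T : 'rV[R]_m -> 'rV[R]_n).

(** Hadamard's lemma at T x turns the increment of F into a linear expression in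
the increments of the T_i, with coefficients continuous at T x. *)
Lemma is_derive_comp V F T x v (dT : 'I_n -> R) : open V -> Ck 1 V F ->
    V (T x) ->
  (forall i, is_derive x v (fun y => T y 0 i) (dT i)) ->
  is_derive x v (F \o T) (\sum_i dT i * 'D_(delta_mx 0 i) F (T x)).
Proof.
move=> oV CF Vx dTP.
have [r /= r0 BV] := (nbhs_ballP _ _).1 (open_nbhs_nbhs (conj oV Vx)).
have {}CF := Ck_subset BV CF.
pose g := hadamard_coef (T x) F.
have cg i : {for T x, continuous (g i)}.
  exact: (Ck_continuous (Ck_hadamard_coef i CF)) (ballxx _ r0).
have cT : (fun h : R => T (h *: v + x)) @ (0 : R) --> T x.
  apply: cvg_rV => i; have [/derivable1P d _] := dTP i.
  have := differentiable_continuous ((derivable1_diffP _ _).1 d).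
  by rewrite /prop_for /continuous_at scale0r add0r.
have C : (\sum_i (h^-1 *: (T (h *: v + x) 0 i - T x 0 i)) *
  g i (T (h *: v + x)))
    @[h --> 0^'] --> \sum_i dT i * 'D_(delta_mx 0 i) F (T x).
  apply: (@cvg_big _ _ +%R) => [|i _]; first exact: add_continuous.
  apply: cvgM.
    by have [/cvg_ex [l dl] <-] := dTP i; rewrite /derive (cvg_lim _ dl).
  rewrite -hadamard_coef_center -/g.
  apply: (@cvg_comp _ _ _ (fun h : R => T (h *: v + x)) (g i) _ (nbhs (T x))).
    by apply: cvg_within_filter; exact: cT.
  exact: cg.
have {}C : (h^-1 *: ((F \o T \o shift x) (h *: v) - (F \o T) x)) @[h --> 0^']
  -->
   \sum_i dT i * 'D_(delta_mx 0 i) F (T x).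
  apply: cvg_trans C; apply: near_eq_cvg.
  have : \forall h \near (0 : R)^', ball (T x) r (T (h *: v + x)).
    apply: cvg_within; apply: cT; exact: nbhsx_ballx.
  apply: filterS => h Bh /=.
  rewrite (hadamard CF Bh) [F (T x) + _]addrC addrK [RHS]mulr_sumr.
  by apply: eq_bigr => i _; rewrite -[in LHS]mulrA.
apply: DeriveDef; first by apply/cvg_ex; eexists; exact: C.
exact/cvg_lim.
Qed.

Lemma Ck_comp k U V F T : open U -> open V -> (forall x, U x -> V (T x)) ->
  (forall i, Ck k U (fun x => T x 0 i)) -> Ck k V F -> Ck k U (F \o T).
Proof.
move=> oU oV UV.
have cT k' : (forall i, Ck k' U (fun x => T x 0 i)) -> forall x, U x ->
  {for x, continuous T}.
  by move=> CT x Ux; apply: (@cvg_rV _ _ _ (nbhs x)) => i;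
    exact: (Ck_continuous (CT i)).
elim: k F => [|k IH] F CT CF.
  split=> // x Ux; apply: continuous_comp; first exact: (cT _ CT).
  by apply: (Ck_continuous CF); exact: UV.
apply: CkS_is_derive => // [x Ux|j].
  apply: continuous_comp; first exact: (cT _ CT).
  by apply: (Ck_continuous CF); exact: UV.
exists (fun x => \sum_i 'D_(delta_mx 0 j) (fun y => T y 0 i) x *
  'D_(delta_mx 0 i) F (T x)).
  move=> x Ux; apply: (is_derive_comp oV); last first.
  - by move=> i; exact: (Ck_is_derive (CT i)).
  - exact: UV.
  - exact: CkS_Ck1 CF.
apply: Ck_sum => // i; apply: CkM => //; first by have [_ /(_ j) []] := CT i.
by apply: (IH ('D_(delta_mx 0 i) F));
  [move=> l; exact: CkW|have [_ /(_ i) []] := CF].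
Qed.

End ChainRule.

(** * Extending functions from a chart to the manifold *)

Lemma open_within_preimage (S T : topologicalType) (f : S -> T) (A : set S)
    (B : set T) :
  open A -> {within A, continuous f} -> open B -> open (A `&` f @^-1` B).
Proof.
move=> oA; rewrite continuous_open_subspace // => cf oB.
rewrite openE => x [Ax Bfx]; apply: filterI; first exact: open_nbhs_nbhs.
by apply: cf; [exact: mem_set|exact: open_nbhs_nbhs].
Qed.

Lemma closed_ball_compact (R : realType) (n : nat) (a : 'rV[R]_n)
    (r : R) : compact (closed_ball a r).
Proof.
apply: bounded_closed_compact; last exact: closed_ball_closed.
have [r0|r0] := ltP 0 r; last by rewrite closed_ball0 //; by exists 0;
  split => // ? _ ?.
exists (`|a| + r); split; first by rewrite num_real.
move=> M' ltM x; rewrite closed_ballE // /closed_ball_ /= => ax.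
rewrite -[x](subrK a); apply: le_trans (ler_normD _ _) _.
by rewrite distrC; lra.
Qed.

Section ChartExtension.
Variables (R : realType) (n : nat) (M : manifold R n).
Implicit Types (c : chart R n M) (F : 'rV[R]_n -> R) (m p : M).
Local Notation im c := (chart_map c @` chart_dom c).

Lemma chart_mapK_in c m : chart_dom c m -> chart_inv c (chart_map c m) = m.
Proof. by move=> dm; apply: chart_mapK; exact: mem_set. Qed.

Lemma chart_inv_dom c x : im c x -> chart_dom c (chart_inv c x).
Proof. by move=> [m dm <-]; rewrite chart_mapK_in. Qed.

Lemma chart_invK c x : im c x -> chart_map c (chart_inv c x) = x.
Proof. by move=> [m dm <-]; rewrite chart_mapK_in. Qed.

Definition chart_extend c F m : R :=
  if `[< chart_dom c m >] then F (chart_map c m) else 0.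

Lemma chart_extend_in c F m : chart_dom c m -> chart_extend c F m =
    F (chart_map c m).
Proof. by move=> dm; rewrite /chart_extend asboolT. Qed.

Lemma chart_extend_out c F m : ~ chart_dom c m -> chart_extend c F m = 0.
Proof. by move=> dm; rewrite /chart_extend asboolF. Qed.

(** A function supported in a closed ball inside the chart extends by 0.  The
ball is compact, so its image in the manifold is compact, hence closed as the
manifold is Hausdorff: off this image the extension is locally 0, and near it
the extension is a composite with a transition map. *)
Lemma chart_extend_smooth c a r V F : atlas c -> 
  open V -> closed_ball a r `<=` V -> V `<=` im c -> (forall k, Ck k V F) ->
  (forall x, F x != 0 -> closed_ball a r x) ->
  chart_extend c F \in @smooth_pred R n M.
Proof.
move=> ac oV BV Vim CF suppF; apply/asboolP => c' ac' k.
pose K := chart_inv c @` closed_ball a r.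
have cK : closed K.
  apply: compact_closed; first exact: manifold_hausdorff.
  apply: continuous_compact; last exact: closed_ball_compact.
  by apply: continuous_subspaceW (@chart_inv_continuous _ _ _ c) => x /BV /Vim.
have oim c1 : open (im c1) by exact: chart_img_open.
have cinv c1 := @chart_inv_continuous _ _ _ c1.
apply: Ck_local => x imx; set m := chart_inv c' x.
have [[dm Vm]|nVm] := pselect (chart_dom c m /\ V (chart_map c m)).
  pose W := im c' `&` chart_inv c' @^-1` (chart_dom c `&` chart_map c @^-1` V).
  have oW : open W.
    apply: open_within_preimage => //; apply: open_within_preimage => //.
      exact: chart_open.
    exact: chart_map_continuous.
  exists W; split => //.
  apply: (@Ck_ext _ _ _ _ (F \o (fun y => chart_map c (chart_inv c' y)))) => //.
    by move=> y /set_mem [imy [dy _]]; rewrite /= chart_extend_in.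
  apply: (Ck_comp oW oV) => // [y [_ [_ Vy]] //|i].
  apply: Ck_subset (atlas_smooth ac' ac i k) => y [imy [dy _]].
  exists (chart_inv c' y); last exact: chart_invK.
  by split=> //; exact: chart_inv_dom.
exists (im c' `&` chart_inv c' @^-1` (~` K)); split.
- by apply: open_within_preimage => //; exact: closed_openC.
- split=> // -[z Bz zm]; apply: nVm.
  have imz := Vim _ (BV _ Bz).
  have -> : m = chart_inv c z by rewrite zm.
  split; first exact: chart_inv_dom.
  by rewrite chart_invK //; exact: BV.
- apply: Ck_ext (Ck_cst k _ 0).
    by apply: open_within_preimage => //; exact: closed_openC.
  move=> y /set_mem [imy nKy] /=; rewrite /cst; apply/esym.
  have [dy|ndy] := pselect (chart_dom c (chart_inv c' y));
    last exact: chart_extend_out.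
  rewrite chart_extend_in //; apply: contrapT => /eqP /suppF By; apply: nKy.
  by exists (chart_map c (chart_inv c' y)) => //; exact: chart_mapK_in.
Qed.

Lemma bump_extend_smooth c a r V F : 0 < r -> atlas c ->
  open V -> closed_ball a r `<=` V -> V `<=` im c -> (forall k, Ck k V F) ->
  chart_extend c (fun x => smooth_bump a r x * F x) \in @smooth_pred R n M.
Proof.
move=> r0 ac oV BV Vim CF; apply: (chart_extend_smooth ac oV BV Vim).
  by move=> k; apply: (CkM oV _ (CF k)); exact: Ck_smooth_bump.
move=> x; have [->|b0 _] := eqVneq (smooth_bump a r x) 0; first
  by rewrite mul0r eqxx.
by apply: subset_closed_ball; exact: smooth_bump_out.
Qed.

End ChartExtension.

Section CinfMore.
Variables (R : realType) (n : nat) (M : manifold R n).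
Implicit Types (f g : cinf M) (X Y Z : vfield M).

Lemma cinf_sumE (I : Type) (r : seq I) (P : pred I) (F : I -> cinf M) p :
  (\sum_(i <- r | P i) F i) p = \sum_(i <- r | P i) F i p.
Proof. by apply: (big_morph (fun f : cinf M => f p)). Qed.

Lemma vfield_sumE (I : Type) (r : seq I) (P : pred I) (F : I -> vfield M) f :
  (\sum_(i <- r | P i) F i) f = \sum_(i <- r | P i) F i f.
Proof. by apply: (big_morph (fun X : vfield M => X f)). Qed.

Lemma vfield_sum X (I : Type) (r : seq I) (P : pred I) (F : I -> cinf M) :
  X (\sum_(i <- r | P i) F i) = \sum_(i <- r | P i) X (F i).
Proof.
apply: (big_morph X); first exact: vfieldD.
by apply: (addrI (X 0)); rewrite -vfieldD !addr0.
Qed.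

Lemma vfield_cst X (a : R) : X (cinf_cst M a) = 0.
Proof.
have X1 : X 1 = 0.
  by apply: (addrI (X 1)); rewrite addr0 -{3}[1]mulr1 vfieldM mulr1 mul1r.
have -> : cinf_cst M a = cinf_cst M a * 1 by rewrite mulr1.
by rewrite vfieldC X1 mulr0.
Qed.

End CinfMore.

(** * Coordinate frames *)

Section ChartFrame.
Variables (R : realType) (n : nat) (M : manifold R n) (c : chart R n M).
Hypothesis ac : atlas c.
Local Notation im := (chart_map c @` chart_dom c).
Variables (a : 'rV[R]_n) (r : R).
Hypotheses (r0 : 0 < r) (Hr : closed_ball a r `<=` im).
Implicit Types (f h : cinf M) (Z : vfield M).
Local Notation b := (smooth_bump a r).

Definition cutoff F (CF : smooth_on im F) : cinf M :=
  Cinf (bump_extend_smooth r0 ac (@chart_img_open _ _ _ c) Hr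
    (@subset_refl _ im) CF).

Lemma cutoff_in F (CF : smooth_on im F) q : chart_dom c q ->
  cutoff CF q = b (chart_map c q) * F (chart_map c q).
Proof. by move=> dq; rewrite -[LHS]/(chart_extend c _ q) chart_extend_in. Qed.

Lemma cutoff_out F (CF : smooth_on im F) q : ~ chart_dom c q -> cutoff CF q = 0.
Proof. by move=> dq; rewrite -[LHS]/(chart_extend c _ q) chart_extend_out. Qed.

Lemma chart_rep_smooth f : smooth_on im (f \o chart_inv c).
Proof. by move=> k; have /asboolP := valP f; apply. Qed.

Lemma chart_partial_smooth f j :
    smooth_on im ('D_(delta_mx 0 j) (f \o chart_inv c)).
Proof. by move=> k; have [_ /(_ j) []] := chart_rep_smooth f k.+1. Qed.

Lemma chart_rep_derive f j x : im x -> 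
  is_derive x (delta_mx 0 j) (f \o chart_inv c)
    ('D_(delta_mx 0 j) (f \o chart_inv c) x).
Proof. by move=> imx; exact: (Ck_is_derive (chart_rep_smooth f 1)). Qed.

Definition coord_field_fun (j : 'I_n) f : cinf M :=
    cutoff (chart_partial_smooth f j).

Lemma im_chart q : chart_dom c q -> im (chart_map c q).
Proof. by move=> dq; exists q. Qed.
Hint Resolve im_chart : core.

Lemma coord_field_subproof j : coord_field_fun j \in @derivation_pred R n M.
Proof.
apply/asboolP; split=> [f g|s f|f g]; apply: cinfP => q.
- rewrite cinfD /coord_field_fun; have [dq|nq] := pselect (chart_dom c q);
  last first.
    by rewrite !cutoff_out // addr0.
  have [df _] := chart_rep_derive f j (im_chart dq).
  have [dg _] := chart_rep_derive g j (im_chart dq).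
  by rewrite !cutoff_in // -mulrDr -deriveD.
- rewrite cinfM /coord_field_fun; have [dq|nq] := pselect (chart_dom c q);
  last first.
    by rewrite !cutoff_out // mulr0.
  have [df _] := chart_rep_derive f j (im_chart dq).
  by rewrite !cutoff_in // mulrCA; congr (_ * _); rewrite -[RHS]deriveZ.
- rewrite cinfD !cinfM /coord_field_fun; have [dq|nq] :=
  pselect (chart_dom c q); last first.
    by rewrite !cutoff_out // !(mulr0, mul0r) addr0.
  have [df _] := chart_rep_derive f j (im_chart dq).
  have [dg _] := chart_rep_derive g j (im_chart dq).
  rewrite !cutoff_in // (_ : (f * g : cinf M) \o chart_inv c = 
    (f \o chart_inv c) * (g \o chart_inv c)) // deriveM //.
  rewrite -[f q](congr1 f (chart_mapK_in dq))
    -[g q](congr1 g (chart_mapK_in dq)).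
  by rewrite /GRing.scale /=; ring.
Qed.

Definition coord_field j : vfield M := Vfield (coord_field_subproof j).

Lemma coord_fieldE j f : coord_field j f = cutoff (chart_partial_smooth f j).
Proof. by []. Qed.

Definition chart_bump : cinf M := cutoff (fun k => Ck_cst k im 1).

Definition chart_coord (i : 'I_n) : cinf M :=
  cutoff (fun k => Ck_coord k i (@chart_img_open _ _ _ c)).

(** On the chart, with b the bump function, this is b d(b x_i) - b x_i db =
b^2 dx_i, a multiple of dx_i built from functions on the whole manifold. *)
Definition coord_form (i : 'I_n) : Defs.form M 1 :=
  chart_bump *: diff_fun (chart_coord i) - chart_coord i *: diff_fun chart_bump.

Lemma coord_formE i Z : app1 (coord_form i) Z =
  chart_bump * Z (chart_coord i) - chart_coord i * Z chart_bump.
Proof. by []. Qed.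

Definition frame_scale : cinf M := chart_bump * chart_bump * chart_bump.

Lemma chart_bump_in q : chart_dom c q -> chart_bump q = b (chart_map c q).
Proof. by move=> dq; rewrite cutoff_in // mulr1. Qed.

Lemma frame_scaleE q : frame_scale q = chart_bump q ^+ 3.
Proof. by rewrite !cinfM; ring. Qed.

(** b^2 dx_i applied to b d/dx_j. *)
Lemma coord_form_field i j :
  app1 (coord_form i) (coord_field j) = frame_scale * (i == j)%:R.
Proof.
apply: cinfP => q; rewrite [RHS]cinfM frame_scaleE coord_formE cinfD cinfN
  !cinfM.
have -> : ((i == j)%:R : cinf M) q = (i == j)%:R :> R by case: eqP.
have [dq|nq] := pselect (chart_dom c q); last first.
  have b0 : chart_bump q = 0 by exact: cutoff_out.
  have u0 : chart_coord i q = 0 by exact: cutoff_out.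
  by rewrite b0 u0 expr0n !mul0r subr0.
rewrite !coord_fieldE chart_bump_in // !cutoff_in //.
set x := chart_map c q; have imx : im x by exact: im_chart.
have nim : \forall y \near x, im y.
  by apply: open_nbhs_nbhs; split=> //; exact: chart_img_open.
have [db _] : is_derive x (delta_mx 0 j) b ('D_(delta_mx 0 j) b x).
  apply: (@Ck_is_derive _ _ 0 im) => //.
  by apply: Ck_smooth_bump; exact: chart_img_open.
have [dc dcE] := is_derive_coord x (delta_mx 0 j) i.
have -> : 'D_(delta_mx 0 j) (chart_bump \o chart_inv c) x =
  'D_(delta_mx 0 j) b x.
  apply: near_eq_derive; apply: filterS nim => y imy.
  by rewrite -[LHS]/(chart_bump (chart_inv c y)) chart_bump_in ?chart_invK //;
    exact: chart_inv_dom.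
have -> : 'D_(delta_mx 0 j) (chart_coord i \o chart_inv c) x =
    b x * (delta_mx 0 j : 'rV[R]_n) 0 i + x 0 i * 'D_(delta_mx 0 j) b x.
  rewrite -dcE -[RHS]/(_ *: _ + _ *: _) -deriveM //.
  apply: near_eq_derive; apply: filterS nim => y imy.
  by rewrite -[LHS]/(chart_coord i (chart_inv c y)) cutoff_in ?chart_invK //;
    exact: chart_inv_dom.
rewrite mxE eqxx /=; ring.
Qed.

(** A derivation is determined at q by its values on coordinates.  Hadamard's
lemma at q, multiplied by bump functions so as to hold on the whole manifold,
writes f - f(q) as a combination of functions x_i - x_i(q) that vanish at q;
applying Z leaves only the terms where Z differentiates such a function, and
the Hadamard coefficients at q are the partial derivatives of f. *)
Lemma vfield_localize Z f q : chart_dom c q ->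
  chart_bump q * Z f q = \sum_i
    (Z (chart_coord i) q - chart_map c q 0 i * Z chart_bump q) *
    'D_(delta_mx 0 i) (f \o chart_inv c) (chart_map c q).
Proof.
move=> dq; set x := chart_map c q; have imx : im x by exact: im_chart.
have oim := @chart_img_open _ _ _ c.
have [s /= s0 Bs] := (nbhs_ballP _ _).1 (open_nbhs_nbhs (conj oim imx)).
pose F := f \o chart_inv c; pose g := hadamard_coef x F.
have CF k : Ck k (ball x s) F := Ck_subset Bs (chart_rep_smooth f k).
have s2 : 0 < s / 2 by lra.
have oB : open (ball x s) by exact: ball_open.
have sub2 : closed_ball x (s / 2) `<=` ball x s.
  by apply: closed_ball_subset; lra.
pose Psi : cinf M := Cinf (bump_extend_smooth s2 ac oB sub2 Bs (fun k =>
  Ck_cst k _ 1)).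
pose G i : cinf M := Cinf (bump_extend_smooth s2 ac oB sub2 Bs
  (fun k => Ck_hadamard_coef i (CF k.+1))).
have GE i m : chart_dom c m -> G i m = smooth_bump x (s / 2) (chart_map c m) *
  g i (chart_map c m).
  by move=> dm; rewrite -[LHS]/(chart_extend c _ m) chart_extend_in.
have PE m : chart_dom c m -> Psi m = smooth_bump x (s / 2) (chart_map c m).
  by move=> dm; rewrite -[LHS]/(chart_extend c _ m) chart_extend_in // mulr1.
have H : Psi * chart_bump * (f - cinf_cst M (f q)) =
    \sum_i (chart_coord i - cinf_cst M (x 0 i) * chart_bump) * G i.
  apply: cinfP => m; rewrite cinf_sumE !cinfM cinfD cinfN.
  have [dm|nm] := pselect (chart_dom c m); last first.
    rewrite -[Psi m]/(chart_extend c _ m) chart_extend_out // !mul0r big1 // =>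
      i _.
    by rewrite cinfM -[G i m]/(chart_extend c _ m) chart_extend_out // mulr0.
  rewrite PE // chart_bump_in //; set y := chart_map c m.
  under eq_bigr => i _ do rewrite !(cinfM, cinfD, cinfN) GE // cutoff_in //
    chart_bump_in // -/y.
  have [->|by0] := eqVneq (smooth_bump x (s / 2) y) 0.
    by rewrite !mul0r big1 // => i _; rewrite mul0r mulr0.
  have By : ball x s y.
    by apply: le_ball (smooth_bump_out s2 by0); lra.
  have Hm : f m = f q + \sum_i (y 0 i - x 0 i) * g i y.
    by have := hadamard (CF 1) By; rewrite -/g /F /comp !chart_mapK_in.
  rewrite Hm.
  rewrite -[cinf_cst M (f q) m]/(f q) [f q + _]addrC addrK mulr_sumr.
  apply: eq_bigr => i _; rewrite -[cinf_cst M (x 0 i) m]/(x 0 i); ring.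
have ZH : (Z (Psi * chart_bump * (f - cinf_cst M (f q)))) q =
    (Z (\sum_i (chart_coord i - cinf_cst M (x 0 i) * chart_bump) * G i)) q
      by rewrite H.
move: ZH; rewrite vfieldM vfieldD vfieldN vfield_cst subr0 vfield_sum cinf_sumE.
rewrite !(cinfD, cinfM, cinfN) -[cinf_cst M (f q) q]/(f q) subrr mulr0 addr0.
rewrite PE // -/x smooth_bump_center // mul1r => E;
  rewrite -[LHS]/(chart_bump q * Z f q) E.
apply: eq_bigr => i _; rewrite vfieldM !(cinfD, cinfM, cinfN).
rewrite vfieldD vfieldN vfieldC !(cinfD, cinfM, cinfN)
  -[cinf_cst M (x 0 i) q]/(x 0 i).
rewrite cutoff_in // chart_bump_in // GE // -/x smooth_bump_center // mul1r.
by rewrite /g hadamard_coef_center; ring.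
Qed.

Lemma chart_frame_expansion Z :
  frame_scale *: Z = \sum_i app1 (coord_form i) Z *: coord_field i.
Proof.
apply: vfieldP => f; rewrite vfield_sumE; apply: cinfP => q.
rewrite vfieldZE cinfM frame_scaleE cinf_sumE.
under eq_bigr => i _ do rewrite vfieldZE cinfM coord_formE cinfD cinfN !cinfM
  coord_fieldE.
have [dq|nq] := pselect (chart_dom c q); last first.
  rewrite {1}/chart_bump cutoff_out // expr0n mul0r big1 // => i _.
  by rewrite cutoff_out // mulr0.
rewrite exprSr -mulrA vfield_localize // mulr_sumr.
apply: eq_bigr => i _; rewrite !cutoff_in // mulr1; ring.
Qed.

(** Logarithmic derivative of the square of h, along the coordinate fields,
where it is a statement about partial derivatives. *)
Lemma coord_field_ln j h (s : cinf M) : (forall p, h p != 0) ->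
    (forall p, s p = ln (h p ^+ 2)) ->
  h * coord_field j s = (1 + 1) * coord_field j h.
Proof.
move=> h0 sE; apply: cinfP => q; rewrite !cinfM !coord_fieldE.
have [dq|nq] := pselect (chart_dom c q); last by rewrite !cutoff_out // !mulr0.
rewrite !cutoff_in //; set x := chart_map c q; have imx : im x
  by exact: im_chart.
have dh := chart_rep_derive h j imx;
  set dhx := 'D_(delta_mx 0 j) (h \o chart_inv c) x in dh *.
have hx : (h \o chart_inv c) x = h q by rewrite /= chart_mapK_in.
have p0 : 0 < (h \o chart_inv c) x * (h \o chart_inv c) x.
  by rewrite hx -expr2 lt0r sqrf_eq0 h0 sqr_ge0.
have [_] := is_derive_comp1 (is_deriveM dh dh) (is_derive1_ln p0).
rewrite (_ : @ln R \o _ = s \o chart_inv c); last first.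
  by apply/funext => y; rewrite /= sE expr2.
move=> ->; rewrite hx cinfD -[(1 : cinf M) q]/(1 : R) -![h q *: dhx]/(h q *
  dhx).
by field; exact: h0.
Qed.

End ChartFrame.

Section LocalFrame.
Variables (R : realType) (n : nat) (M : manifold R n).

(** The factor [rho] is what allows both identities to hold on the whole
manifold: wherever it is nonzero the X_i and the th_i are dual bases up to this
factor, and elsewhere the identities carry no information. *)
Definition frame_at (p : M) (rho : cinf M) (X : 'I_n -> vfield M)
    (th : 'I_n -> Defs.form M 1) :=
  [/\ rho p = 1, forall Z, rho *: Z = \sum_i app1 (th i) Z *: X i &
      forall i j, app1 (th i) (X j) = rho * (i == j)%:R].

Lemma chart_frame (p : M) : exists c (ac : atlas c) a r (r0 : 0 < r)
  (Hr : closed_ball a r `<=` chart_map c @` chart_dom c),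
  frame_at p (frame_scale ac r0 Hr) (coord_field ac r0 Hr)
    (coord_form ac r0 Hr).
Proof.
have [c ac dp] := atlas_cover p; set a := chart_map c p.
have ima : (chart_map c @` chart_dom c) a by exists p.
have [s /= s0 Bs] := (nbhs_ballP _ _).1
  (open_nbhs_nbhs (conj (@chart_img_open _ _ _ c) ima)).
have s2 : 0 < s / 2 by lra.
have Hr : closed_ball a (s / 2) `<=` chart_map c @` chart_dom c.
  by apply: subset_trans Bs; apply: closed_ball_subset; lra.
exists c, ac, a, (s / 2), s2, Hr; split.
- by rewrite frame_scaleE chart_bump_in // smooth_bump_center // expr1n.
- exact: chart_frame_expansion.
- exact: coord_form_field.
Qed.

Lemma exists_frame (p : M) : exists rho X th, frame_at p rho X th.
Proof.
by have [c [ac [a [r [r0 [Hr H]]]]]] := chart_frame p; do 3 eexists; exact: H.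
Qed.

(** The function is ln (h^2) / 2, the logarithm of the absolute value of h. *)
Lemma exists_log_primitive (h : cinf M) : (forall p, h p != 0) ->
  exists s : cinf M, forall Z : vfield M, h * Z s = Z h.
Proof.
move=> h0.
have ls : (fun p => ln (h p ^+ 2)) \in @smooth_pred R n M.
  apply/asboolP => c ac k; apply: Ck_ln; first exact: chart_img_open.
    by move=> x _; rewrite /= lt0r sqrf_eq0 h0 sqr_ge0.
  have /asboolP /(_ c ac k) Ch := valP h.
  apply: Ck_ext (CkM (@chart_img_open _ _ _ c) Ch Ch);
    first exact: chart_img_open.
  by move=> x _; rewrite /= expr2.
pose s : cinf M := Cinf ls.
exists (cinf_cst M 2^-1 * s) => Z; apply: cinfP => p.
have [c [ac [a [r [r0 [Hr [rho1 E _]]]]]]] := chart_frame p.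
have EZ f : Z f p = \sum_i app1 (coord_form ac r0 Hr i) Z p *
  coord_field ac r0 Hr i f p.
  rewrite -[LHS]mul1r -rho1 -[LHS]/((frame_scale ac r0 Hr *: Z) f p) E
    vfield_sumE.
  by rewrite cinf_sumE.
rewrite vfieldC !cinfM !EZ.
rewrite -[cinf_cst M 2^-1 p]/(2^-1 : R) !mulr_sumr; apply: eq_bigr => i _.
have := congr1 (fun f : cinf M =>
  f p) (coord_field_ln ac r0 Hr i h0 (fun p => erefl (s p))).
rewrite !cinfM cinfD -[(1 : cinf M) p]/(1 : R) => H.
transitivity (2^-1 * app1 (coord_form ac r0 Hr i) Z p *
  (h p * coord_field ac r0 Hr i s p)).
  by ring.
by rewrite H; field.
Qed.

End LocalFrame.

(** * Alternating multilinear maps *)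

Section AlternatingMaps.
Variables (C : comPzRingType) (V : lmodType C) (k : nat).
Implicit Types (w f g : altform V k) (v : 'I_k -> V) (i j : 'I_k).

Lemma altformP f g : (forall v, f v = g v) -> f = g.
Proof. by move=> fg; apply/val_inj/funext. Qed.

Lemma altform_scaleE (c : C) f v : (c *: f) v = c * f v. Proof. by []. Qed.

Lemma altform_lin f v i (c : C) u x :
  f (upd v i (c *: u + x)) = c * f (upd v i u) + f (upd v i x).
Proof. by have /asboolP [lf _] := valP f; exact: lf. Qed.

Lemma altform_alt f v i j : i != j -> v i = v j -> f v = 0.
Proof. by have /asboolP [_ af] := valP f; exact: af. Qed.

Lemma altform_add f v i u x :
  f (upd v i (u + x)) = f (upd v i u) + f (upd v i x).
Proof. by rewrite -{1}[u]scale1r altform_lin mul1r. Qed.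

Lemma altform_zero f v i : f (upd v i 0) = 0.
Proof. by apply: (addrI (f (upd v i 0))); rewrite -altform_add !addr0. Qed.

Lemma altform_scale f v i (c : C) u : f (upd v i (c *: u)) = c * f (upd v i u).
Proof. by rewrite -[c *: u]addr0 altform_lin altform_zero addr0. Qed.

Lemma altform_sub f v i u x :
  f (upd v i (u - x)) = f (upd v i u) - f (upd v i x).
Proof. by rewrite altform_add -scaleN1r altform_scale mulN1r. Qed.

Lemma altform_sum f v i (I : Type) (r : seq I) (F : I -> V) :
  f (upd v i (\sum_(l <- r) F l)) = \sum_(l <- r) f (upd v i (F l)).
Proof.
elim: r => [|l r IH]; first by rewrite !big_nil altform_zero.
by rewrite !big_cons altform_add IH.
Qed.

Lemma upd_eq v i u : upd v i u i = u. Proof. by rewrite /upd eqxx. Qed.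
Lemma upd_neq v i j u : j != i -> upd v i u j = v j.
Proof. by rewrite /upd => /negPf ->. Qed.
Lemma upd_id v i : upd v i (v i) = v.
Proof. by apply/funext => j; rewrite /upd; case: eqVneq => [->|]. Qed.
Lemma upd_upd v i u x : upd (upd v i u) i x = upd v i x.
Proof. by apply/funext => j; rewrite /upd; case: eqP. Qed.
Lemma updC v i j u x : i != j -> upd (upd v i u) j x = upd (upd v j x) i u.
Proof.
move=> ij; apply/funext => l; rewrite /upd; case: eqP => // ->.
by rewrite eq_sym (negPf ij).
Qed.

Lemma altform_swap f v i j : i != j -> f (v \o tperm i j) = - f v.
Proof.
move=> ij; apply/eqP; rewrite -addr_eq0; apply/eqP.
pose W u x := f (upd (upd v i u) j x).
have Wa u u' x : W (u + u') x = W u x + W u' x.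
  by rewrite /W !(updC _ _ _ ij) altform_add.
have Wb u x x' : W u (x + x') = W u x + W u x' by rewrite /W altform_add.
have W0 u : W u u = 0.
  by rewrite /W; apply: (altform_alt _ ij); rewrite upd_eq upd_neq // upd_eq.
have -> : f v = W (v i) (v j) by rewrite /W upd_id upd_id.
have -> : f (v \o tperm i j) = W (v j) (v i).
  congr (f _); apply/funext => l; rewrite /= /upd.
  by case: tpermP => [->|->|/eqP/negPf -> /eqP/negPf ->];
    rewrite ?eqxx // (negPf ij).
have := W0 (v i + v j); rewrite Wa !Wb !W0 add0r addr0.
by rewrite addrC.
Qed.

(** A transposition changes the value by a sign, and s is a product of
transpositions. *)
Lemma altform_perm_eq0 f v (s : {perm 'I_k}) : f v = 0 -> f (v \o s) = 0.
Proof.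
have [ts -> _] := prod_tpermP s; elim: ts v => [|t ts IH] v fv.
  by rewrite big_nil (_ : v \o _ = v) //; apply/funext => l; rewrite /= perm1.
rewrite big_cons (_ : v \o _ = (v \o (\prod_(t <- ts) tperm t.1 t.2)%g) \o
  tperm t.1 t.2).
  have [tt|tn] := eqVneq t.1 t.2; last by rewrite altform_swap // IH // oppr0.
  rewrite tt tperm1 (_ : _ \o (1%g : {perm 'I_k}) =
    v \o (\prod_(t <- ts) tperm t.1 t.2)%g) ?IH //.
  by apply/funext => l; rewrite /= perm1.
by apply/funext => l; rewrite /= permM.
Qed.

(** By multilinearity, one slot at a time, the entries may be assumed to belong
to the family X; then either two of them agree or they are a permutation
of X. *)
Lemma altform_span_eq0 f (X v : 'I_k -> V) : f X = 0 ->
  (forall j, exists c : 'I_k -> C, v j = \sum_i c i *: X i) -> f v = 0.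
Proof.
move=> fX.
suff H (m : nat) u : (m <= k)%N ->
    (forall j, (j < m)%N -> exists c : 'I_k -> C, u j = \sum_i c i *: X i) ->
    (forall j, (m <= j)%N -> exists i, u j = X i) -> f u = 0.
  by move=> spv; apply: (H k) => // j; rewrite leqNgt ltn_ord.
elim: m u => [|m IH] u mk spu bu.
  have [s sE] : exists s : 'I_k -> 'I_k, forall j, u j = X (s j).
    by have [s sE] := choice (fun j => bu j (leq0n j)); exists s.
  have -> : u = X \o s by apply/funext => j; rewrite sE.
  have [/injectiveP sI|/injectiveP sI] := boolP (injectiveb s).
    have -> : X \o s = X \o perm sI by apply/funext => j; rewrite /= permE.
    exact: altform_perm_eq0.
  have [i [j [ij sij]]] : exists i j, i != j /\ s i = s j.
    apply: contrapT => nex; apply: sI => i j sij; apply: contrapT => /eqP ij.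
    by apply: nex; exists i, j.
  by apply: (altform_alt _ ij); rewrite /= sij.
pose jm := Ordinal mk.
have [c cE] := spu jm (ltnSn m).
rewrite -(upd_id u jm) cE altform_sum big1 // => i _.
rewrite altform_scale IH ?mulr0 //; first exact: ltnW.
  move=> j jlt; rewrite upd_neq; first by apply: spu; exact: ltnW.
  by rewrite -val_eqE /= ltn_eqF.
move=> j mj; have [->|jn] := eqVneq j jm; first by rewrite upd_eq; exists i.
rewrite upd_neq //; apply: bu; rewrite ltn_neqAle mj andbT.
by move: jn; rewrite -val_eqE /= eq_sym.
Qed.

Lemma altform_scale_all f v (c : C) : f (fun j => c *: v j) = c ^+ k * f v.
Proof.
suff H (m : nat) : (m <= k)%N ->
    f (fun j => if (j < m)%N then c *: v j else v j) = c ^+ m * f v.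
  by rewrite -H //; congr (f _); apply/funext => j; rewrite ltn_ord.
elim: m => [_|m IH mk]; first by rewrite expr0 mul1r.
pose u := (fun j : 'I_k => if (j < m)%N then c *: v j else v j).
pose jm := Ordinal mk.
rewrite exprS -mulrA -(IH (ltnW mk)) -/u.
have -> : (fun j : 'I_k => if (j < m.+1)%N then c *: v j else v j) =
  upd u jm (c *: v jm).
  apply/funext => j; rewrite /upd /u -val_eqE /= ltnS leq_eqVlt.
  by case: eqVneq => // E; rewrite (_ : j = jm) //; exact: val_inj.
rewrite altform_scale (_ : v jm = u jm) ?upd_id //.
by rewrite /u /= ltnn.
Qed.

Section Action.
Variables (D : C -> C) (T : V -> V).
Hypotheses (DD : forall a b, D (a + b) = D a + D b)
  (DM : forall a b, D (a * b) = a * D b + D a * b)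
  (TL : forall a u x, T (a *: u + x) = a *: T u + D a *: u + T x).

Lemma action_split f v i x :
  \sum_l f (upd (upd v i x) l (T (upd v i x l))) =
  f (upd v i (T x)) + \sum_(l | l != i) f (upd (upd v l (T (v l))) i x).
Proof.
rewrite (bigD1 i) //= upd_eq upd_upd; congr (_ + _).
by apply: eq_bigr => l li; rewrite upd_neq // updC // eq_sym.
Qed.

(** A derivation [D] of the scalars and an operator [T] over it act on
alternating maps.  The terms D(a) produced by f and by [T] cancel, which gives
linearity; when two entries agree, the two terms that differentiate them are
exchanged by a transposition.  Lie derivatives (D = X, T = [X,.]) and traces
(D = 0, T linear) are both instances. *)
Lemma action_subproof f :
  (fun v => D (f v) - \sum_i f (upd v i (T (v i)))) \in altform_pred (V :=
    V) (k := k).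
Proof.
have D0 : D 0 = 0 by apply: (addrI (D 0)); rewrite -DD !addr0.
apply/asboolP; split=> [v i a u x|v i j ij vij].
  pose S x := \sum_(l | l != i) f (upd (upd v l (T (v l))) i x).
  have SE : S (a *: u + x) = a * S u + S x.
    rewrite /S mulr_sumr -big_split /=; apply: eq_bigr => l _;
      exact: altform_lin.
  rewrite !action_split -!/(S _) SE TL altform_lin DD DM altform_add altform_lin
    altform_scale.
  by ring.
rewrite (altform_alt _ ij vij) D0 sub0r (bigD1 i) //= (bigD1 j) 1?eq_sym //=.
rewrite big1 ?addr0; last first.
  move=> l /andP[li lj]; apply: (altform_alt _ ij).
  by rewrite !upd_neq // eq_sym.
have -> : f (upd v i (T (v i))) = - f (upd v j (T (v j))).
  rewrite -(altform_swap _ _ ij); congr (f _); apply/funext => l;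
    rewrite /= /upd.
  case: tpermP => [->|->|/eqP/negPf -> /eqP/negPf ->] //.
    by rewrite !eqxx vij.
  by rewrite (negPf ij) [j == i]eq_sym (negPf ij) vij.
by rewrite addNr oppr0.
Qed.

Definition action f : altform V k := Altform (action_subproof f).

End Action.

End AlternatingMaps.

(** * Forms of top degree *)

Section TopDegree.
Variables (R : realType) (n : nat) (M : manifold R n).
Implicit Types (f g h : cinf M) (p : M).

Lemma cinf_exprE f (k : nat) p : (f ^+ k) p = f p ^+ k.
Proof. by elim: k => [|k IH] //; rewrite !exprS cinfM IH. Qed.

(** The denominator may depend on the point; where it is nonzero the function is
locally a quotient of smooth functions. *)
Lemma smooth_quotient (f : M -> R) :
  (forall p, exists g h : cinf M, h p != 0 /\ forall q, f q * h q = g q) ->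
  f \in @smooth_pred R n M.
Proof.
move=> H; apply/asboolP => c ac k; apply: Ck_local => x imx.
have [g [h [hx gE]]] := H (chart_inv c x).
have oim := @chart_img_open _ _ _ c.
have /asboolP /(_ c ac k) Ch := valP h; have /asboolP /(_ c ac k) Cg := valP g.
pose W := chart_map c @` chart_dom c `&` (h \o chart_inv c) @^-1`
  [set t | t != 0].
have oW : open W.
  apply: open_within_preimage => //.
  by apply: continuous_in_subspaceT => y /set_mem imy;
    exact: (Ck_continuous Ch).
exists W; split => //.
have sub : W `<=` chart_map c @` chart_dom c by move=> y [].
have hW y : W y -> (h \o chart_inv c) y != 0 by move=> [].
apply: Ck_ext oW _ (CkM oW (Ck_subset sub Cg) (CkV oW hW (Ck_subset sub Ch))).
move=> y /set_mem Wy.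
by rewrite -[LHS]/(g (chart_inv c y) * (h (chart_inv c y))^-1) -gE mulfK // hW.
Qed.

Section Forms.
Variables (V : lmodType (cinf M)) (k : nat).
Implicit Types (w mu : altform V k) (X Y Z : 'I_k -> V).

(** The map w0 certifies that the family is independent at p. Stating this for
an arbitrary module makes the results below available both for vector fields
and for 1-forms. *)
Definition top_frame p (rho : cinf M) X := [/\ rho p = 1,
  forall z : V, exists c : 'I_k -> cinf M, rho *: z = \sum_i c i *: X i &
  exists w0 : altform V k, w0 X p != 0].

Hypothesis frames : forall p, exists rho X, top_frame p rho X.

(** The map w(X) mu - mu(X) w vanishes on X, hence on all families at p. *)
Lemma top_frame_proportional p rho X w mu Z : top_frame p rho X ->
  w X p * mu Z p = mu X p * w Z p.
Proof.
move=> [rho1 sp _]; pose W := w X *: mu - mu X *: w.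
have WX : W X = 0.
  by rewrite -[LHS]/(w X * mu X - mu X * w X) mulrC subrr.
have := altform_span_eq0 WX (fun j => sp (Z j)).
rewrite altform_scale_all => /(congr1 (fun f : cinf M => f p)).
rewrite cinfM cinf_exprE rho1 expr1n mul1r.
rewrite -[W Z]/(w X * mu Z - mu X * w Z) cinfD cinfN !cinfM.
by move/eqP; rewrite subr_eq0 => /eqP.
Qed.

Lemma top_proportional w mu Y Z : w Y * mu Z = w Z * mu Y.
Proof.
apply: cinfP => p; rewrite !cinfM; have [rho [X fX]] := frames p.
have [_ _ [w0 w0X]] := fX.
apply: (mulfI w0X); apply: (mulfI w0X).
have E w' Z' := top_frame_proportional w0 w' Z' fX.
transitivity ((w0 X p * w Y p) * (w0 X p * mu Z p)); first by ring.
transitivity ((w0 X p * w Z p) * (w0 X p * mu Y p)); last by ring.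
by rewrite !E; ring.
Qed.

Variable mu : altform V k.
Hypothesis mu0 : nowhere_vanishing mu.

Lemma top_frame_neq0 p rho X : top_frame p rho X -> mu X p != 0.
Proof.
move=> fX; have [_ _ [w0 w0X]] := fX; have [Y muY] := mu0 p.
have := top_frame_proportional w0 mu Y fX; apply: contra_eqN => /eqP ->.
by rewrite mul0r mulf_neq0.
Qed.

Lemma nowhere_vanishing_cancel f g : (forall Y, f * mu Y = g * mu Y) -> f = g.
Proof.
move=> fg; apply: cinfP => p; have [Y muY] := mu0 p; apply: (mulIf muY).
by rewrite -!cinfM fg.
Qed.

Lemma top_quotient w : exists f, w = f *: mu.
Proof.
pose F p := w (projT1 (cid (mu0 p))) p / mu (projT1 (cid (mu0 p))) p.
have FE p Y : F p * mu Y p = w Y p.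
  rewrite /F; case: cid => Z /= muZ; apply: (mulIf muZ).
  by rewrite mulrAC divfK // -!cinfM -top_proportional.
have sF : F \in @smooth_pred R n M.
  apply: smooth_quotient => p; have [Y muY] := mu0 p; exists (w Y), (mu Y).
  by split=> // q; exact: FE.
exists (Cinf sF); apply: altformP => Y; apply: cinfP => p.
by rewrite altform_scaleE cinfM -FE.
Qed.

End Forms.

Section OneForms.
Implicit Types (al : Defs.form M 1) (X Y Z : vfield M).

Lemma app1_lin al f X Y : app1 al (f *: X + Y) = f * app1 al X + app1 al Y.
Proof.
have E Z : app1 al Z = al (upd (fun=> 0) ord0 Z).
  by congr (al _); apply/funext => i; rewrite /upd ord1 eqxx.
by rewrite !E altform_lin.
Qed.

Lemma app1_scale al f X : app1 al (f *: X) = f * app1 al X.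
Proof.
have a0 : app1 al 0 = 0.
  by apply: (addrI (app1 al 0));
    rewrite -{1}[app1 al 0]mul1r -app1_lin scale1r !addr0.
by rewrite -[f *: X]addr0 app1_lin a0 addr0.
Qed.

Lemma app1_sum al (I : Type) (r : seq I) (F : I -> vfield M) :
  app1 al (\sum_(i <- r) F i) = \sum_(i <- r) app1 al (F i).
Proof.
elim: r => [|i r IH]; first
  by rewrite !big_nil -[0 in LHS](scale0r 0) app1_scale mul0r.
by rewrite !big_cons -[F i]scale1r app1_lin mul1r scale1r IH.
Qed.

Lemma form1P al be : (forall X, app1 al X = app1 be X) -> al = be.
Proof.
move=> E; apply: altformP => v.
have -> : v = (fun=> v ord0) by apply/funext => i; rewrite ord1.
exact: E.
Qed.

Lemma app1_sum_form (I : Type) (r : seq I) (F : I -> Defs.form M 1) X :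
  app1 (\sum_(i <- r) F i) X = \sum_(i <- r) app1 (F i) X.
Proof. by apply: (big_morph (fun al => app1 al X)). Qed.

Lemma coframe_subproof (th : 'I_n -> Defs.form M 1) :
  (fun Y : 'I_n -> vfield M => \det (\matrix_(i, j) app1 (th i) (Y j)))
    \in altform_pred (V := vfield M) (k := n).
Proof.
have -> : (fun Y : 'I_n -> vfield M => \det (\matrix_(i, j) app1 (th i) (Y j)))
  =
    (fun Y : 'I_n -> vfield M => \det (\matrix_(i, j) app1 (th j) (Y i))).
  by apply/funext => Y; rewrite -det_tr; congr (\det _); apply/matrixP => i j;
    rewrite !mxE.
apply/asboolP; split=> [v i a u w|v i j ij vij].
  rewrite -[X in _ = _ + X]mul1r; apply: (@determinant_multilinear _ _ _ _ _ i).
  - by apply/rowP => j; rewrite !mxE /upd eqxx app1_lin mul1r.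
  - by apply/matrixP=> l j; rewrite !mxE /upd eq_sym (negPf (neq_lift i l)).
  - by apply/matrixP=> l j; rewrite !mxE /upd eq_sym (negPf (neq_lift i l)).
by apply: (determinant_alternate ij) => l; rewrite !mxE vij.
Qed.

Definition coframe_form th : Defs.form M n := Altform (coframe_subproof th).

Lemma frame_at_wedge p rho (X : 'I_n -> vfield M) th : frame_at p rho X th ->
  wedge X th p = 1.
Proof.
move=> [rho1 _ dual]; rewrite
  -[wedge X th]/(\det (\matrix_(i, j) app1 (th i) (X j))).
rewrite (_ : \matrix_(_, _) _ = rho%:M) ?det_scalar ?cinf_exprE ?rho1
  ?expr1n //.
by apply/matrixP => i j; rewrite !mxE dual mulr_natr.
Qed.

Lemma vfield_top_frame p rho (X : 'I_n -> vfield M) th : frame_at p rho X th ->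
  top_frame p rho X.
Proof.
move=> fX; have [rho1 sp dual] := fX; split=> //.
  by move=> Z; exists (fun i => app1 (th i) Z).
by exists (coframe_form th); rewrite (frame_at_wedge fX) oner_eq0.
Qed.

(** The same frame, read backwards: rho al = sum_i al(X_i) th_i. *)
Lemma form_top_frame p rho (X : 'I_n -> vfield M) th : frame_at p rho X th ->
  top_frame p rho th.
Proof.
move=> fX; have [rho1 sp dual] := fX; split=> //.
  move=> al; exists (fun i => app1 al (X i)); apply: form1P => Z.
  rewrite -[LHS]/(rho * app1 al Z) -app1_scale sp app1_sum app1_sum_form.
  by apply: eq_bigr => i _;
    rewrite app1_scale -[RHS]/(app1 al (X i) * app1 (th i) Z) mulrC.
by exists (wedge X); rewrite (frame_at_wedge fX) oner_eq0.
Qed.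

Lemma vfield_top_frames p : exists rho (X : 'I_n -> vfield M),
    top_frame p rho X.
Proof. by have [rho [X [th /vfield_top_frame]]] := exists_frame p;
  exists rho, X. Qed.

Lemma form_top_frames p : exists rho (th : 'I_n -> Defs.form M 1),
    top_frame p rho th.
Proof. by have [rho [X [th /form_top_frame]]] := exists_frame p;
  exists rho, th. Qed.

End OneForms.

End TopDegree.

(** * The trace of an endomorphism of the tangent bundle *)

Section Trace.
Variables (R : realType) (n : nat) (M : manifold R n).
Variable mu : Defs.form M n.
Hypothesis mu0 : nowhere_vanishing mu.
Implicit Types (f g h t : cinf M) (p : M) (X Y Z : vfield M) (S T : vfield M ->
  vfield M).

Definition endomorphism T := forall f X Y, T (f *: X + Y) = f *: T X + T Y.

Lemma endomorphism_scale T f X : endomorphism T -> T (f *: X) = f *: T X.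
Proof.
move=> TL; have T0 : T 0 = 0.
  by apply: (addrI (T 0)); rewrite -{1}[T 0]scale1r -TL scale1r !addr0.
by rewrite -[f *: X]addr0 TL T0 addr0.
Qed.

Lemma endomorphism_add T X Y : endomorphism T -> T (X + Y) = T X + T Y.
Proof. by move=> TL; rewrite -[X]scale1r TL !scale1r. Qed.

Lemma endomorphism_sub T X Y : endomorphism T -> T (X - Y) = T X - T Y.
Proof.
by move=> TL; rewrite endomorphism_add // -[- Y]scaleN1r endomorphism_scale //
  scaleN1r.
Qed.

Lemma endomorphism_sum T (I : Type) (r : seq I) (F : I -> vfield M) :
    endomorphism T ->
  T (\sum_(i <- r) F i) = \sum_(i <- r) T (F i).
Proof.
move=> TL; elim: r => [|i r IH].
  by rewrite !big_nil -[0 in LHS](scale0r 0) endomorphism_scale // scale0r.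
by rewrite !big_cons endomorphism_add // IH.
Qed.

Definition derive_slots (w : Defs.form M n) T (Y : 'I_n -> vfield M) : cinf M :=
  \sum_i w (upd Y i (T (Y i))).

Definition trace_of T t := forall Y : 'I_n -> vfield M, derive_slots mu T Y =
    t * mu Y.

Lemma trace_of_exists T : endomorphism T -> exists t, trace_of T t.
Proof.
move=> TL.
have D0D (a b : cinf M) : 0 = 0 + 0 :> cinf M by rewrite addr0.
have D0M (a b : cinf M) : 0 = a * 0 + 0 * b :> cinf M
  by rewrite mulr0 mul0r addr0.
have T0L a u x : T (a *: u + x) = a *: T u + 0 *: u + T x
  by rewrite scale0r addr0.
pose w := action (D := fun=> 0) D0D D0M T0L mu.
have [f wE] := top_quotient (@vfield_top_frames _ _ M) mu0 w.
exists (- f) => Y; have := congr1 (fun w : Defs.form M n => w Y) wE.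
rewrite -[w Y]/(0 - derive_slots mu T Y) sub0r -[(f *: mu) Y]/(f * mu Y) => E.
by rewrite mulNr -E opprK.
Qed.

Lemma trace_of_frame T t p rho (X : 'I_n -> vfield M) th : endomorphism T ->
    trace_of T t ->
  frame_at p rho X th -> t p = \sum_i app1 (th i) (T (X i)) p.
Proof.
move=> TL tT fX; have [rho1 sp dual] := fX.
have muX := top_frame_neq0 mu0 (vfield_top_frame fX).
apply: (mulIf muX); rewrite -cinfM -tT /derive_slots -[LHS]mul1r -{1}rho1
  -cinfM.
rewrite mulr_sumr cinf_sumE mulr_suml; apply: eq_bigr => i _.
rewrite -altform_scale sp altform_sum (bigD1 i) //= altform_scale upd_id big1
  ?addr0 //.
move=> j ji; rewrite altform_scale (altform_alt mu (i := i) (j := j)) ?mulr0 //.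
  by rewrite eq_sym.
by rewrite upd_eq upd_neq.
Qed.

Lemma frame_at_expand p rho (X : 'I_n -> vfield M) th (al : Defs.form M 1) Z :
  frame_at p rho X th -> app1 al Z p = \sum_i app1 (th i) Z p * app1 al (X i) p.
Proof.
move=> [rho1 sp _]; rewrite -[LHS]mul1r -rho1 -cinfM -app1_scale sp app1_sum
  cinf_sumE.
by apply: eq_bigr => i _; rewrite app1_scale cinfM.
Qed.

Lemma frame_at_expand_endo p rho (X : 'I_n -> vfield M) th
    (al : Defs.form M 1) T Z :
  endomorphism T -> frame_at p rho X th ->
  app1 al (T Z) p = \sum_i app1 (th i) Z p * app1 al (T (X i)) p.
Proof.
move=> TL [rho1 sp _]; rewrite -[LHS]mul1r -rho1 -cinfM -app1_scale
  -endomorphism_scale //.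
rewrite sp endomorphism_sum // app1_sum cinf_sumE.
by apply: eq_bigr => i _; rewrite endomorphism_scale // app1_scale cinfM.
Qed.

(** Dual bases at p need not extend to a frame.  Comparing them with a frame
gives mutually inverse matrices A and B, and the matrix of N in the given bases
is A N' B with N' the matrix in the frame. *)
Lemma trace_of_is_trace (N : {linear vfield M -> vfield M}) t :
  trace_of N t -> is_trace N t.
Proof.
have NL : endomorphism N by move=> f X Y; rewrite linearP.
move=> tN p X th dual; have [rho [X' [th' fX]]] := exists_frame p.
pose A : 'M[R]_n := \matrix_(i, k) app1 (th i) (X' k) p.
pose B : 'M[R]_n := \matrix_(k, j) app1 (th' k) (X j) p.
pose N' : 'M[R]_n := \matrix_(k, l) app1 (th' k) (N (X' l)) p.
have AB : A *m B = 1%:M.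
  apply/matrixP => i j; rewrite !mxE -dual (frame_at_expand _ _ fX).
  by apply: eq_bigr => k _; rewrite !mxE mulrC.
have -> : \matrix_(i, j) app1 (th i) (N (X j)) p = A *m (N' *m B).
  apply/matrixP => i j; rewrite !mxE (frame_at_expand _ _ fX).
  apply: eq_bigr => k _; rewrite !mxE mulrC; congr (_ * _).
  rewrite (frame_at_expand_endo _ _ NL fX).
  by apply: eq_bigr => l _; rewrite !mxE mulrC.
rewrite mxtrace_mulC -mulmxA (mulmx1C AB) mulmx1 (trace_of_frame NL tN fX).
by apply: eq_bigr => i _; rewrite mxE.
Qed.

Lemma is_trace_unique (N : {linear vfield M -> vfield M}) t t' :
  is_trace N t -> is_trace N t' -> t = t'.
Proof.
move=> tN tN'; apply: cinfP => p; have [rho [X [th [rho1 _ dual]]]] :=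
  exists_frame p.
have dX : dual_at p X th.
  by move=> i j; rewrite dual cinfM rho1 mul1r; case: eqP.
by rewrite (tN p X th dX) (tN' p X th dX).
Qed.

Lemma trace_of_trace (N : {linear vfield M -> vfield M}) : trace_of N (trace N).
Proof.
have NL : endomorphism N by move=> f X Y; rewrite linearP.
have [t tN] := trace_of_exists NL; have itN := trace_of_is_trace tN.
suff -> : trace N = t by [].
apply: (@is_trace_unique N) => //.
exact: (xgetPex 0 (ex_intro (fun t => is_trace N t) t itN)).
Qed.

(** In a frame both traces are the same double sum, read in two orders. *)
Lemma trace_of_comp_comm S T t t' : endomorphism S -> endomorphism T ->
  trace_of (S \o T) t -> trace_of (T \o S) t' -> t = t'.
Proof.
move=> SL TL tST tTS; apply: cinfP => p.
have compL A B : endomorphism A -> endomorphism B -> endomorphism (A \o B).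
  by move=> AL BL f X Y; rewrite /= BL AL.
have [rho [X [th fX]]] := exists_frame p.
rewrite (trace_of_frame (compL _ _ SL TL) tST fX)
  (trace_of_frame (compL _ _ TL SL) tTS fX) /=.
under eq_bigr do rewrite (frame_at_expand_endo _ _ SL fX).
under [RHS]eq_bigr do rewrite (frame_at_expand_endo _ _ TL fX).
rewrite exchange_big /=; apply: eq_bigr => i _; apply: eq_bigr => j _;
  exact: mulrC.
Qed.

Lemma trace_of_add S T s t : trace_of S s -> trace_of T t ->
  trace_of (fun X => S X + T X) (s + t).
Proof.
move=> sS tT Y; rewrite mulrDl -sS -tT /derive_slots -big_split /=.
by apply: eq_bigr => i _; rewrite altform_add.
Qed.

Lemma trace_of_unique T t t' : trace_of T t -> trace_of T t' -> t = t'.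
Proof.
by move=> tT tT'; apply: (nowhere_vanishing_cancel mu0) => Y; rewrite -tT -tT'.
Qed.

Definition lie_endo X T Y := lie_bracket X (T Y) - T (lie_bracket X Y).

Lemma lie_endo_endomorphism X T : endomorphism T -> endomorphism (lie_endo X T).
Proof.
move=> TL f Y Z; rewrite /lie_endo TL !lie_bracketDr !lie_bracketZr.
rewrite !(endomorphism_add _ _ TL) !(endomorphism_scale _ _ TL).
by apply: vfield_eval => e r eD eN eZ; rewrite !(eD, eN, eZ); ring.
Qed.

Lemma lie_form_multiple X : exists d, forall Y : 'I_n ->
    vfield M, lie_form X mu Y = d * mu Y.
Proof.
have DT a u x : lie_bracket X (a *: u + x) = a *: lie_bracket X u + X a *: u +
  lie_bracket X x.
  by rewrite lie_bracketDr lie_bracketZr.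
pose w := action (vfieldD X) (vfieldM X) DT mu.
have [d wE] := top_quotient (@vfield_top_frames _ _ M) mu0 w.
exists d => Y; exact: (congr1 (fun w : Defs.form M n => w Y) wE).
Qed.

Lemma lie_form_upd X (Y : 'I_n -> vfield M) i Z :
  X (mu (upd Y i Z)) = lie_form X mu (upd Y i Z) +
    mu (upd Y i (lie_bracket X Z)) +
    \sum_(j | j != i) mu (upd (upd Y j (lie_bracket X (Y j))) i Z).
Proof.
rewrite /lie_form (bigD1 i) //= upd_eq upd_upd.
rewrite [X in _ - (_ + X)](eq_bigr (fun j =>
  mu (upd (upd Y j (lie_bracket X (Y j))) i Z))); last first.
  by move=> j ji; rewrite upd_neq // updC // eq_sym.
by rewrite -addrA subrK.
Qed.

(** Differentiate the equation that defines the trace along X.  The Lie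
derivative of mu is a multiple d mu, which contributes the same amount to both
sides.  What is left are the terms (a and b) in which X and T act on the same
slot, and the terms (S) in which they act on different slots and therefore
commute. *)
Lemma trace_of_lie_endo X T t : endomorphism T -> trace_of T t ->
  trace_of (lie_endo X T) (X t).
Proof.
move=> TL tT Y; have [d dE] := lie_form_multiple X.
pose c := \sum_j mu (upd Y j (lie_bracket X (Y j))).
pose a := \sum_i mu (upd Y i (lie_bracket X (T (Y i)))).
pose b := \sum_i mu (upd Y i (T (lie_bracket X (Y i)))).
pose S := \sum_i \sum_(j | j != i) mu
  (upd (upd Y j (lie_bracket X (Y j))) i (T (Y i))).
have E1 : X (derive_slots mu T Y) = d * (t * mu Y) + a + S.
  rewrite -tT {1}/derive_slots vfield_sum.
  under eq_bigr do rewrite lie_form_upd dE.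
  by rewrite !big_split /= -mulr_sumr.
have E2 : t * c = b + S.
  rewrite mulr_sumr; under eq_bigr do rewrite -tT.
  rewrite /S [X in _ + X](exchange_big_dep xpredT) //= -big_split /=;
    apply: eq_bigr => j _.
  rewrite /derive_slots (bigD1 j) //= upd_eq upd_upd; congr (_ + _).
  rewrite [RHS](eq_bigl (fun i => i != j)); last by move=> i; rewrite eq_sym.
  by apply: eq_bigr => i ij; rewrite upd_neq.
have E3 : X (mu Y) = d * mu Y + c by rewrite -dE /lie_form subrK.
have -> : derive_slots mu (lie_endo X T) Y = a - b.
  by rewrite -sumrB; apply: eq_bigr => i _; rewrite altform_sub.
have {}E1 : a = t * (d * mu Y + c) + X t * mu Y - d * (t * mu Y) - S.
  by rewrite -E3 -vfieldM -{1}tT E1; ring.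
have {}E2 : b = t * c - S by rewrite E2 addrK.
by rewrite E1 E2; ring.
Qed.

End Trace.

(** * The Lie derivation on top multivector fields *)

Section DualVolume.
Variables (R : realType) (n : nat) (M : manifold R n).
Variable mu : Defs.form M n.
Hypothesis mu0 : nowhere_vanishing mu.
Implicit Types (f g h t : cinf M) (p : M) (X Y Z : 'I_n -> vfield M) (th :
  'I_n -> Defs.form M 1).

Definition dual_volume (eta : mvfield M n) :=
  forall th X, eta th * mu X = wedge X th.

(** For fixed th the determinant of the th_i(X_j) is a form of top degree in X,
hence a multiple of mu; the factor is the value at th. *)
Lemma dual_volume_exists : exists eta, dual_volume eta.
Proof.
have [F FE] := choice (fun th =>
  top_quotient (@vfield_top_frames _ _ M) mu0 (coframe_form th)).
have FP th X : F th * mu X = wedge X th by rewrite -altform_scaleE -FE.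
have sF : F \in altform_pred (V := Defs.form M 1) (k := n).
  apply/asboolP; split=> [v i a u w|v i j ij vij].
    by apply: (nowhere_vanishing_cancel mu0) => X;
      rewrite mulrDl -mulrA !FP altform_lin.
  by apply: (nowhere_vanishing_cancel mu0) => X;
    rewrite mul0r FP (altform_alt _ ij).
by exists (Altform sF).
Qed.

Variable eta : mvfield M n.
Hypothesis etaP : dual_volume eta.

Lemma dual_volume_nowhere_vanishing : nowhere_vanishing eta.
Proof.
move=> p; have [rho [X [th fX]]] := exists_frame p; exists th.
have := frame_at_wedge fX; rewrite -etaP cinfM => E.
by apply: contra_eqN E => /eqP ->; rewrite mul0r eq_sym oner_eq0.
Qed.

Lemma wedge_dual_volume X : wedge X = mu X *: eta.
Proof. by apply: altformP => th; rewrite -etaP altform_scaleE mulrC. Qed.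

Lemma mvfield_multiple (P : mvfield M n) : exists f, P = f *: eta.
Proof. exact: (top_quotient (@form_top_frames _ _ M)
  dual_volume_nowhere_vanishing). Qed.

Lemma dual_volume_cancel f g : f *: eta = g *: eta -> f = g.
Proof.
move=> fg; apply: (nowhere_vanishing_cancel dual_volume_nowhere_vanishing) =>
  th.
by rewrite -!altform_scaleE fg.
Qed.

Section LieDerivation.
Variables (A : lie_algebroid M) (a : vfield M) (kappa : cinf M).
Hypothesis kappaP : forall X,
  kappa * mu X = \sum_i mu (upd X i (bracket A a (X i))) - anchor A a (mu X).

(** The value on one wedge of vector fields determines the value on eta, because
each wedge is a multiple of eta and mu vanishes nowhere. *)
Lemma lie_derivation_eta L : is_lie_derivation A a (k := n) L ->
    L eta = kappa *: eta.
Proof.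
move=> [LD LM Lw].
have [c cE] := mvfield_multiple (L eta); rewrite cE; congr (_ *: _).
apply: (nowhere_vanishing_cancel mu0) => X.
apply: dual_volume_cancel; rewrite kappaP scalerBl.
apply/eqP; rewrite eq_sym subr_eq; apply/eqP.
rewrite mulrC -scalerA -cE addrC -LM -wedge_dual_volume Lw scaler_suml.
by apply: eq_bigr => i _; rewrite wedge_dual_volume.
Qed.

(** Every multivector field is q eta for a unique function q, and the derivation
is defined through q.  It has the required values on all wedges precisely
because kappa does not depend on the vector fields. *)
Lemma lie_derivation_exists : exists L, is_lie_derivation A a (k := n) L.
Proof.
have [q qE] := choice mvfield_multiple.
have qD P Q : q (P + Q) = q P + q Q.
  by apply: dual_volume_cancel; rewrite -qE scalerDl -!qE.
have qZ f P : q (f *: P) = f * q P.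
  by apply: dual_volume_cancel; rewrite -qE -scalerA -!qE.
exists (fun P => (anchor A a (q P) + q P * kappa) *: eta); split.
- move=> P Q; rewrite qD vfieldD -scalerDl; congr (_ *: _); ring.
- move=> f P; rewrite qZ vfieldM {4}(qE P) !scalerA -scalerDl; congr (_ *: _);
  ring.
- move=> b; have -> : q (wedge b) = mu b.
    by apply: dual_volume_cancel; rewrite -qE wedge_dual_volume.
  rewrite [mu b * _]mulrC kappaP addrC subrK scaler_suml.
  by apply: eq_bigr => i _; rewrite wedge_dual_volume.
Qed.

Lemma lie_mvfield_multiple f :
  lie_mvfield A a (f *: eta) = (anchor A a f + f * kappa) *: eta.
Proof.
have [L LP] := lie_derivation_exists.
have : exists P, [set L (f *: eta) | L in is_lie_derivation A a (k := n)] P.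
  by exists (L (f *: eta)), L.
move=> /(xgetPex 0) [L' L'P E]; rewrite /lie_mvfield -E.
have [_ LM _] := L'P.
by rewrite LM (lie_derivation_eta L'P) scalerA -scalerDl.
Qed.

End LieDerivation.
End DualVolume.

(** * Cochains of degree zero and one *)

Section LowDegree.
Variables (R : realType) (n : nat) (M : manifold R n) (A : lie_algebroid M).

Lemma dA_form0 (s : Defs.form M 0) a v : dA A s a = anchor A (a ord0) (s v).
Proof.
rewrite /dA !big_ord_recl !big_ord0 /= !addr0 expr0 mul1r.
rewrite [X in _ + X]big_pred0 ?addr0; last by move=> j; rewrite ord1.
by rewrite (_ : (fun l : 'I_0 => _) = v) //; apply/funext => -[].
Qed.

Lemma dA_form1 (w : Defs.form M 1) a (X := a ord0) (Y := a (lift ord0 ord0)) :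
  dA A w a = anchor A X (app1 w Y) - anchor A Y (app1 w X)
    - app1 w (bracket A X Y).
Proof.
have c (v : 'I_1 -> vfield M) : w v = app1 w (v ord0).
  by congr (w _); apply/funext => l; rewrite ord1.
have S1 (F : 'I_2 -> cinf M) : \sum_(j < 2 | (0 < j)%N) F j =
  F (lift ord0 ord0).
  by rewrite big_mkcond !big_ord_recl big_ord0 /= add0r addr0.
have S2 (F : 'I_2 -> cinf M) : \sum_(j < 2 | (bump 0 0 < j)%N) F j = 0.
  by rewrite big_pred0 // => -[[|[|]]].
rewrite /dA !big_ord_recl !big_ord0 S1 S2 /= !c -/X -/Y.
rewrite (_ : lift (lift ord0 ord0) ord0 = ord0 :> 'I_2) -/X;
  last exact: val_inj.
by rewrite expr0 mul1r /bump /= !add0n !addr0 !expr1 !mulN1r.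
Qed.

Lemma exact_form1P (w : Defs.form M 1) :
  exact_form A w <-> exists s : cinf M, forall X, app1 w X = anchor A X s.
Proof.
split=> [[s sE]|[s sE]].
  exists (s (fun=> 0)) => X.
  by rewrite -(dA_form0 s (fun=> X) (fun=> 0)) -sE.
have sP : (fun _ : 'I_0 -> vfield M => s) \in altform_pred (V := vfield M) (k :=
  0).
  by apply/asboolP; split=> [v []|v []].
exists (Altform sP) => a;
  rewrite (dA_form0 (Altform sP) a (fun=> 0)) -[RHS]/(anchor A (a ord0) s) -sE.
by congr (w _); apply/funext => i; rewrite ord1.
Qed.

Lemma coset_of_class_eq (c : cohomology A 1) (w xi : Defs.form M 1)
    (hw : closed_form A w) :
  exact_form A (xi - w) -> coset_of_class c xi -> c = coh_class hw.
Proof.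
move=> /exact_form1P [s sE]; case: c => S SP /= Sxi.
have SE : S = [set w' | exact_form A (w' - w)].
  have [w0 cl0 E0] := SP; rewrite E0 in Sxi *.
  have [s0 s0E] := (exact_form1P (xi - w0)).1 Sxi.
  apply/seteqP; split=> w' Hw'; apply/exact_form1P.
    have [s' s'E] := (exact_form1P (w' - w0)).1 Hw'.
    exists (s' + s - s0) => X; rewrite vfieldD vfieldN vfieldD -s'E -sE -s0E.
    by rewrite -![app1 (_ - _) _]/(app1 _ _ - app1 _ _); ring.
  have [s' s'E] := (exact_form1P (w' - w)).1 Hw'.
  exists (s' - s + s0) => X; rewrite vfieldD vfieldD vfieldN -s'E -sE -s0E.
  by rewrite -![app1 (_ - _) _]/(app1 _ _ - app1 _ _); ring.
rewrite /coh_class; move: SP; rewrite SE => SP; congr Cohomology;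
  exact: Prop_irrelevance.
Qed.

End LowDegree.

(** * The modular class of a Nijenhuis algebroid *)

Section ModularClassNijenhuis.
Variables (R : realType) (n : nat) (M : manifold R n).
Variable mu : Defs.form M n.
Hypothesis mu0 : nowhere_vanishing mu.
Variables (N : {linear vfield M -> vfield M}) (nijN : nijenhuis N).
Local Notation A := (nijenhuis_algebroid nijN).
Local Notation t := (trace N).

Let NL : endomorphism N. Proof. by move=> f X Y; rewrite linearP. Qed.

Lemma trace_lie_endo X : trace_of mu (lie_endo X N) (X t).
Proof. exact: trace_of_lie_endo mu0 X _ _ NL (trace_of_trace mu0 N). Qed.

(** The Nijenhuis identity says L_(NX) N = N (L_X N), and
L_X (N^2) = N (L_X N) + (L_X N) N; both summands have the same trace.  The
function s is the trace of N^2. *)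
Lemma nijenhuis_trace_square : exists s : cinf M, forall X, (1 + 1) * N X t =
    X s.
Proof.
have NNL : endomorphism (N \o N) by move=> f X Y; rewrite /= !NL.
have [s sE] := trace_of_exists mu0 NNL; exists s => X.
have LL := lie_endo_endomorphism X NL.
have E1 : lie_endo (N X) N = N \o lie_endo X N.
  apply/funext => Y; rewrite /lie_endo /= (endomorphism_sub _ _ NL).
  have /eqP := nijN X Y; rewrite subr_eq0 => /eqP <-.
  by apply: vfield_eval => e r eD eN _; rewrite !(eD, eN); ring.
have E2 : lie_endo X (N \o N) =
  (fun Y => (N \o lie_endo X N) Y + (lie_endo X N \o N) Y).
  apply/funext => Y; rewrite /lie_endo /= (endomorphism_sub _ _ NL).
  by apply: vfield_eval => e r eD eN _; rewrite !(eD, eN); ring.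
have T1 : trace_of mu (N \o lie_endo X N) (N X t) by rewrite -E1;
  exact: trace_lie_endo.
have LNL : endomorphism (lie_endo X N \o N) by move=> f Y Z; rewrite /= NL LL.
have [u uE] := trace_of_exists mu0 LNL.
have uN : u = N X t by exact: (trace_of_comp_comm mu0 LL NL uE T1).
have := trace_of_lie_endo mu0 X NNL sE; rewrite E2 => T2.
have := trace_of_unique mu0 (trace_of_add T1 uE) T2; rewrite uN => <-.
ring.
Qed.

Lemma dtrace_closed : closed_form A (diff_fun t).
Proof.
move=> a; have [s sE] := nijenhuis_trace_square; rewrite dA_form1.
set X := a ord0; set Y := a _; have dfE (f : cinf M) Z : app1 (diff_fun f) Z =
  Z f by [].
rewrite !dfE.
(* the second derivatives N X (Y t) and N Y (X t) cancel; what remains is minus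
   the differential of the 1-form Z |-> N Z t *)
have E : N X (Y t) - N Y (X t) - nij_bracket N X Y t =
    Y (N X t) - X (N Y t) + N (lie_bracket X Y) t.
  rewrite /nij_bracket vfieldAE vfieldNE vfieldAE !lie_bracketE.
  by apply: cinfP => p; rewrite !(cinfD, cinfN); ring.
rewrite -[LHS]/(N X (Y t) - N Y (X t) - nij_bracket N X Y t) E.
have two (f : cinf M) : (1 + 1) * f = 0 -> f = 0.
  move=> f0; apply: cinfP => p; have := congr1 (fun f : cinf M => f p) f0.
  by rewrite cinfM cinfD -[(1 : cinf M) p]/(1 : R) -![(0 : cinf M) p]/(0 : R) =>
    H; lra.
apply: two; rewrite mulrDr mulrBr sE.
have dd (Z : vfield M) (f : cinf M) : Z ((1 + 1) * f) = (1 + 1) * Z f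
  by rewrite !mulrDl !mul1r vfieldD.
by rewrite -(dd Y) -(dd X) !sE lie_bracketE; apply: cinfP => p;
  rewrite !(cinfD, cinfN) -[RHS]/(0 : R); ring.
Qed.

(** If L_(NX) mu = d mu, the algebroid derivation multiplies eta by
X t - d (step kP), so that d drops out of the sum. *)
Lemma modular_cocycle_multiple (eta : mvfield M n) (f g : cinf M)
    (xi : Defs.form M 1) (muP : dual_volume mu eta)
    (h := f * g) : (forall p, h p != 0) ->
  modular_cocycle A (f *: eta) (g *: mu) xi <->
  forall X, h * app1 xi X = N X h + h * X t.
Proof.
move=> h0; have NV := dual_volume_nowhere_vanishing muP.
have key X th Y : lie_mvfield A X (f *: eta) th * (g *: mu) Y +
    (f *: eta) th * lie_form (N X) (g *: mu) Y = (N X h + h * X t) *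
      (eta th * mu Y).
  have [d dE] := lie_form_multiple mu0 (N X).
  have kP Z : (X t - d) * mu Z =
      \sum_i mu (upd Z i (bracket A X (Z i))) - anchor A X (mu Z).
    rewrite mulrBl -trace_lie_endo -dE /lie_form /derive_slots /=.
    rewrite opprB addrA; congr (_ - _).
    rewrite -big_split /=; apply: eq_bigr => i _; rewrite -altform_add;
      congr (mu (upd _ _ _)).
    rewrite /lie_endo /nij_bracket.
    by apply: vfield_eval => e r eD eN _; rewrite !(eD, eN); ring.
  rewrite (lie_mvfield_multiple mu0 muP kP) !altform_scaleE.
  have -> : lie_form (N X) (g *: mu) Y = (N X g + g * d) * mu Y.
    rewrite mulrDl -mulrA -dE /lie_form altform_scaleE vfieldM.
    under eq_bigr do rewrite altform_scaleE.
    by rewrite -mulr_sumr; ring.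
  by rewrite -[anchor A X f]/(N X f) /h vfieldM; ring.
split=> [H X|H X th Y].
  apply: (nowhere_vanishing_cancel mu0) => Y.
  apply: (nowhere_vanishing_cancel NV) => th.
  have := H X th Y; rewrite -[anchor A X]/(N X) key => E.
  transitivity (app1 xi X * ((f *: eta) th * (g *: mu) Y)).
    by rewrite !altform_scaleE /h; ring.
  by rewrite -E; ring.
rewrite -[anchor A X]/(N X) key -H !altform_scaleE /h; ring.
Qed.

End ModularClassNijenhuis.

Theorem proposition2 (R : realType) (n : nat) (M : manifold R n)
    (orM : orientable M)
    (N : {linear vfield M -> vfield M}) (nijN : nijenhuis N) :
  exists closed_dtrN :
      closed_form (nijenhuis_algebroid nijN) (diff_fun (trace N)),
    forall c : cohomology (nijenhuis_algebroid nijN) 1,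
      is_modular_class c <-> c = coh_class closed_dtrN.
Proof.
have [mu mu0] := orM; exists (dtrace_closed mu0 nijN) => c.
have [eta etaP] := dual_volume_exists mu0.
have eta0 := dual_volume_nowhere_vanishing etaP.
split=> [[eta' [mu' [xi [eta'0 mu'0 xiP cxi]]]]|->].
  have [f fE] := mvfield_multiple etaP eta'.
  have [g gE] := top_quotient (@vfield_top_frames _ _ M) mu0 mu'.
  have h0 p : (f * g) p != 0.
    have [th] := eta'0 p; have [Y] := mu'0 p.
    rewrite fE gE !altform_scaleE !cinfM !mulf_eq0 !negb_or.
    by move=> /andP[-> _] /andP[-> _].
  rewrite fE gE in xiP.
  have {}xiP := (modular_cocycle_multiple mu0 nijN xi etaP h0).1 xiP.
  have [s sE] := exists_log_primitive h0.
  apply: coset_of_class_eq cxi; apply/exact_form1P; exists s => X.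
  apply: cinfP => p; apply: (mulfI (h0 p)); rewrite -!cinfM sE.
  by rewrite -[app1 (_ - _) X]/(app1 xi X - X (trace N)) mulrBr xiP addrK.
exists eta, mu, (diff_fun (trace N)); split=> //.
  rewrite -[eta]scale1r -[mu]scale1r.
  have N1 X : N X 1 = 0.
    by rewrite (_ : 1 = cinf_cst M 1) ?vfield_cst //; exact: cinfP.
  apply: (modular_cocycle_multiple mu0 nijN _ etaP _).2 => [p|X].
    by rewrite mulr1 -[_ p]/(1 : R) oner_eq0.
  by rewrite mulr1 N1 add0r.
by apply/exact_form1P; exists (cinf_cst M 0) => X; rewrite subrr vfield_cst.
Qed.
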